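(* Let $f$ be a periodic traveling wave with $(E,c)\in\mathbb{G}$ and parity index $\gamma$. If $\gamma=1$ (resp., $\gamma=-1$) then the number of positive real points in the periodic partial spectrum $\sigma_0\subset\sigma$, i.e., positive real periodic eigenvalues, is even (resp., odd) when counted according to multiplicity (as zeros of $D(\cdot,1)$). In particular, if $\gamma=-1$ there is at least one positive real periodic eigenvalue, and hence $f$ is spectrally unstable, with the corresponding exponentially growing solution of the linearized equation $v_{tt}-2cv_{zt}+(c^2-1)v_{zz}+V''(f(z))v=0$ having the same spatial period $T$ as $f_z$.
   Context: Potential. $V:\mathbb{R}\to\mathbb{R}$ is of class $C^2$, periodic with fundamental period $2\pi$, has exactly two critical points per period, both non-degenerate, and $\min V=-1$, $\max V=1$. Waves. A traveling wave $u=f(z)$, $z=x-ct$, $c\neq\pm1$, of $u_{tt}-u_{xx}+V'(u)=0$ satisfies $(c^2-1)f_{zz}+V'(f)=0$ and $\tfrac12(c^2-1)f_z^2=E-V(f)$. A periodic traveling wave is one with $f_z$ non-constant and periodic; $T>0$ is the smallest number with $f(z+T)=f(z)$ for all $z$ (librational) or $f(z+T)=f(z)\pm2\pi$ for all $z$ (rotational). $\mathbb{G}$ is the set of $(E,c)$ with: $c^2<1,|E|<1$; $c^2<1,E<-1$; $c^2>1,|E|<1$; or $c^2>1,E>1$. For $(E,c)\in\mathbb{G}$, $f$ is normalized by $f_z(0)>0$ and by $f(0)=\overline u$, a fixed maximizer of $V$ (if $c^2<1$), or $f(0)=\underline u$, a fixed minimizer of $V$ (if $c^2>1$). Spectrum.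 With $$\mathbf{A}(z,\lambda)=\begin{pmatrix}0&1\\-\frac{\lambda^2+V''(f(z))}{c^2-1}&\frac{2c\lambda}{c^2-1}\end{pmatrix},$$ let $\mathcal{T}(\lambda)\mathbf{w}=\mathbf{w}_z-\mathbf{A}(z,\lambda)\mathbf{w}$ on $L^2(\mathbb{R};\mathbb{C}^2)$ with domain $H^1(\mathbb{R};\mathbb{C}^2)$. The spectrum $\sigma\subset\mathbb{C}$ is the complement of the set of $\lambda$ for which $\mathcal{T}(\lambda)$ is one-to-one and onto with bounded inverse. $f$ is spectrally stable if $\sigma\subset i\mathbb{R}$, otherwise spectrally unstable. Let $\mathbf{F}(z,\lambda)$ be the fundamental matrix of $\mathbf{w}_z=\mathbf{A}\mathbf{w}$ with $\mathbf{F}(0,\lambda)=\mathbb{I}$, $\mathbf{M}(\lambda)=\mathbf{F}(T,\lambda)$, $D(\lambda,\mu)=\det(\mathbf{M}(\lambda)-\mu\mathbb{I})$ (entire in $\lambda$). The periodic partial spectrum is $\sigma_0=\{\lambda\in\mathbb{C}:D(\lambda,1)=0\}$; its points are the periodic eigenvalues. Parity index. $D(\cdot,1)$ vanishes at $\lambda=0$ to some even order $2p\ge2$, and $\gamma=\mathrm{sgn}\left((c^2-1)\,\partial_\lambda^{2p}D(0,1)\right)$. *)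

(* Defs.v *)
From HB Require Import structures.
From mathcomp Require Import all_boot all_order all_algebra.
From mathcomp Require Import complex.
From mathcomp Require Import all_classical all_reals all_analysis.
Set Implicit Arguments.
Unset Strict Implicit.
Unset Printing Implicit Defensive.
Import Order.TTheory GRing.Theory Num.Theory.
Import numFieldNormedType.Exports.
Local Open Scope ring_scope.
Local Open Scope complex_scope.
Local Open Scope classical_set_scope.

Record admissible_potential (R : realType) (V : R -> R) : Prop := {
  potential_D1 : forall u, derivable V u 1 ;
  potential_D2 : forall u, derivable (derive1 V) u 1 ;
  potential_C2 : continuous (derive1n 2 V) ;
  potential_periodic : periodic V (2 * pi) ;
  potential_period_min : forall t, 0 < t -> periodic V t -> 2 * pi <= t ;
  potential_critical : exists a b : R,
    [/\ 0 <= a < 2 * pi, 0 <= b < 2 * pi, a != b,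
        forall u, 0 <= u < 2 * pi -> (derive1 V u = 0 <-> u = a \/ u = b) &
        derive1n 2 V a != 0 /\ derive1n 2 V b != 0] ;
  potential_min : (forall u, -1 <= V u) /\ exists u, V u = -1 ;
  potential_max : (forall u, V u <= 1) /\ exists u, V u = 1 }.

Definition admissible_params (R : realType) (E c : R) : Prop :=
  [\/ c ^+ 2 < 1 /\ `|E| < 1, c ^+ 2 < 1 /\ E < -1,
      1 < c ^+ 2 /\ `|E| < 1 | 1 < c ^+ 2 /\ 1 < E].

Record periodic_wave (R : realType) (V : R -> R) (E c : R) (f : R -> R) :
    Prop := {
  wave_speed : c ^+ 2 != 1 ;
  wave_D1 : forall z, derivable f z 1 ;
  wave_D2 : forall z, derivable (derive1 f) z 1 ;
  wave_ode : forall z,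
    (c ^+ 2 - 1) * derive1n 2 f z + derive1 V (f z) = 0 ;
  wave_energy : forall z,
    2^-1 * (c ^+ 2 - 1) * derive1 f z ^+ 2 = E - V (f z) ;
  wave_nonconst : ~ exists k, forall z, derive1 f z = k ;
  wave_slope_periodic : exists2 t, 0 < t & periodic (derive1 f) t }.

(* umax and umin are the fixed maximizer and minimizer of V. *)
Record normalized_wave (R : realType) (V : R -> R) (c umax umin : R)
    (f : R -> R) : Prop := {
  normalized_max : V umax = 1 ;
  normalized_min : V umin = -1 ;
  normalized_slope : 0 < derive1 f 0 ;
  normalized_lt1 : c ^+ 2 < 1 -> f 0 = umax ;
  normalized_gt1 : 1 < c ^+ 2 -> f 0 = umin }.

Definition translation_period (R : realType) (f : R -> R) (t : R) : Prop :=
  [\/ forall z, f (z + t) = f z,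
      forall z, f (z + t) = f z + 2 * pi |
      forall z, f (z + t) = f z - 2 * pi].

Definition wave_period (R : realType) (f : R -> R) (T : R) : Prop :=
  [/\ 0 < T, translation_period f T &
      forall t, 0 < t -> translation_period f t -> T <= t].

Section Floquet.
Variables (R : realType) (V : R -> R) (c : R) (f : R -> R).

Definition coefA (z : R) (l : R[i]) : 'M[R[i]]_2 :=
  let s := (c ^+ 2 - 1)%:C in
  \matrix_(i < 2, j < 2)
    if i == 0 then (if j == 0 then 0 else 1)
    else if j == 0 then - ((l ^+ 2 + (derive1n 2 V (f z))%:C) / s)
    else 2 * c%:C * l / s.

(* R[i] is not normed over R in the libraries: the derivative of a
   complex-valued function of a real variable is taken on both parts. *)
Definition is_deriveC (h : R -> R[i]) (z : R) (d : R[i]) : Prop :=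
  is_derive z (1 : R) (fun x => complex.Re (h x)) (complex.Re d) /\
  is_derive z (1 : R) (fun x => complex.Im (h x)) (complex.Im d).

Definition fundamental_matrix (F : R -> R[i] -> 'M[R[i]]_2) : Prop :=
  forall l, F 0 l = 1%:M /\
    forall z i j, is_deriveC (fun x => F x l i j) z ((coefA z l *m F z l) i j).

(* The codomain R[i]^o carries the normed module structure over R[i] used by
   derive1, so that derivatives of D(., mu) are complex derivatives. *)
Definition floquetD (F : R -> R[i] -> 'M[R[i]]_2) (T : R) (mu l : R[i]) :
    R[i]^o :=
  \det (F T l - mu%:M).

Definition periodic_spectrum (F : R -> R[i] -> 'M[R[i]]_2) (T : R) :
    set R[i] :=
  [set l | floquetD F T 1 l = 0].

End Floquet.

Definition vanishing_order (R : realType) (D : R[i] -> R[i]^o) (l : R[i])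
    (m : nat) : Prop :=
  (forall k, (k < m)%N -> derive1n k D l = 0) /\ derive1n m D l != 0.

(* For D = floquetD F T 1 the derivatives at 0 are real, since the system has
   real coefficients for real l; Re only converts from R[i] to R. *)
Definition parity_index (R : realType) (c : R) (D : R[i] -> R[i]^o) (g : R) :
    Prop :=
  exists p : nat, [/\ (0 < p)%N, vanishing_order D 0 p.*2 &
    g = Num.sg ((c ^+ 2 - 1) * complex.Re (derive1n p.*2 D 0 : R[i]))].

(* D has finitely many positive real zeros, N in total with multiplicity. *)
Definition positive_zero_count (R : realType) (D : R[i] -> R[i]^o) (N : nat) :
    Prop :=
  exists (s : seq R) (m : R -> nat),
    [/\ uniq s, forall x, x \in s <-> 0 < x /\ D x%:C = 0,
        forall x, x \in s -> vanishing_order D x%:C (m x) &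
        N = (\sum_(x <- s) m x)%N].

Section Spectrum.
Variable R : realType.
Let mu := @lebesgue_measure R.

Definition inL2 (w : R -> 'cV[R[i]]_2) : Prop := forall i,
  (fun z => complex.Re (w z i 0)) \in Lfun mu 2%:E /\
  (fun z => complex.Im (w z i 0)) \in Lfun mu 2%:E.

Definition normL2 (w : R -> 'cV[R[i]]_2) : R :=
  Num.sqrt (\sum_(i < 2) \int[mu]_z
    (complex.Re (w z i 0) ^+ 2 + complex.Im (w z i 0) ^+ 2)).

Definition aeeq (w1 w2 : R -> 'cV[R[i]]_2) : Prop :=
  {ae mu, forall z, w1 z = w2 z}.

Definition test_function (phi : R -> R) : Prop :=
  (forall n z, derivable (derive1n n phi) z 1) /\
  exists M, forall z, M < `|z| -> phi z = 0.

Definition weak_derivative (h dh : R -> R) : Prop :=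
  forall phi, test_function phi ->
    \int[mu]_z (h z * derive1 phi z) = - \int[mu]_z (dh z * phi z).

Definition weak_derivativeC2 (w dw : R -> 'cV[R[i]]_2) : Prop := forall i,
  weak_derivative (fun z => complex.Re (w z i 0))
                  (fun z => complex.Re (dw z i 0)) /\
  weak_derivative (fun z => complex.Im (w z i 0))
                  (fun z => complex.Im (dw z i 0)).

Variables (V : R -> R) (c : R) (f : R -> R).

(* The graph of the operator T(l): w belongs to H^1, with weak derivative dw,
   and w_z - A(z, l) w = g in L^2. *)
Definition opT (l : R[i]) (w g : R -> 'cV[R[i]]_2) : Prop :=
  [/\ inL2 w, inL2 g & exists dw, [/\ inL2 dw, weak_derivativeC2 w dw &
    aeeq (fun z => dw z - coefA V c f z l *m w z) g]].

Definition resolvent_set : set R[i] := [set l |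
  [/\ forall w1 w2 g, opT l w1 g -> opT l w2 g -> aeeq w1 w2,
      forall g, inL2 g -> exists w, opT l w g &
      exists K : R, forall w g, opT l w g -> normL2 w <= K * normL2 g]].

Definition spectrum : set R[i] := ~` resolvent_set.

Definition spectrally_stable : Prop :=
  forall l, spectrum l -> complex.Re l = 0.

Definition spectrally_unstable : Prop := ~ spectrally_stable.

(* v_tt - 2 c v_zt + (c^2 - 1) v_zz + V''(f(z)) v = 0, for v = v z t. *)
Definition solves_linearized (v : R -> R -> R) : Prop :=
  exists vt vz vtt vzt vzz : R -> R -> R, forall z t,
    [/\ is_derive t (1 : R) (v z) (vt z t) /\
        is_derive z (1 : R) (v ^~ t) (vz z t),
        is_derive t (1 : R) (vt z) (vtt z t),
        is_derive t (1 : R) (vz z) (vzt z t),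
        is_derive z (1 : R) (vz ^~ t) (vzz z t) &
        vtt z t - 2 * c * vzt z t + (c ^+ 2 - 1) * vzz z t
          + derive1n 2 V (f z) * v z t = 0].

End Spectrum.

(* Main.v *)
Require Import Defs.
From HB Require Import structures.
From mathcomp Require Import all_boot all_order all_algebra.
From mathcomp Require Import complex.
From mathcomp Require Import all_classical all_reals all_analysis.
From mathcomp Require Import measurable_realfun.
From mathcomp Require Import ring lra.
Set Implicit Arguments.
Unset Strict Implicit.
Unset Printing Implicit Defensive.
Import Order.TTheory GRing.Theory Num.Theory.
Import numFieldNormedType.Exports.
Local Open Scope ring_scope.
Local Open Scope complex_scope.
Local Open Scope classical_set_scope.

(** Put s = c^2 - 1 and D(l) = det (F(T, l) - 1).  A zero of D is a value of l
    for which the first-order system has a nonzero T-periodic solution.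

    Inclusion in the spectrum.  A periodic solution w is bounded but not square
    integrable.  Multiplied by the cutoff 1 / (1 + (e z)^2), whose derivative is
    at most e times the cutoff itself, it becomes an element of H^1 whose image
    under the operator has norm at most e times its own norm
    ([bounded_solution_in_spectrum]).  Letting e tend to 0 excludes a bounded
    inverse.

    Parity.  The restriction of D to the positive real axis is a real function
    with finitely many zeros, each of finite order, and the sign of D is
    multiplied by (-1)^m across a zero of order m.  So (-1)^N is the product of
    the sign of D near 0, which is the sign of its first nonzero derivative, and
    the sign of D near +oo.  The latter is the sign of s, and the product of the
    two signs is gamma.  Three facts carry this argument.

    - D is entire with real Taylor coefficients ([floquetD_entire]).  The Taylor
      coefficients in l of the entries of F(T, l) solve a recursive family of
      forced equations; an energy estimate with an exponential weight shows that
      they decay faster than any geometric sequence ([coefficient_decay]) and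
      that the partial sums converge to the solution ([solution_expands]).  The
      determinant of F solves a linear equation whose coefficient is linear in
      l, and is treated as a further instance of the same system.

    - Zeros have finite order ([finite_order]): the derivatives of an entire
      series grow slower than k! r^(-k) for every r, so by Taylor's estimate a
      function flat at one point vanishes on the half-line to its left, hence is
      flat at 0, against the finite order of vanishing assumed there.  Zeros are
      then isolated, and a completeness argument on intervals collects them and
      the sign changes together ([sign_change_count]).

    - For large real l the sign of D is that of s ([floquetD_large]).  With
      k = c l / s, the substitution w = e^(k z) y turns the system into
      y'' = (l^2 / s^2 + q) y with q bounded, and D into
      e^(k T) (2 cosh (k T) - trace).  The trace lies between
      2 cosh (g T) for the constants g^2 below and above the coefficient, while
      k^2 - l^2 / s^2 = l^2 / s exceeds the bound of q in absolute value.

    If gamma = -1 then N is odd, hence some positive l is a zero of D.  The real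
    or the imaginary part of the first component of the periodic solution is a
    nonzero real profile, and multiplying it by e^(l t) solves the linearized
    equation ([growing_solution]). *)

(** * Derivatives of real functions and comparison *)

Section Calculus.
Variable R : realType.
Implicit Types (f g h : R -> R) (a b z : R).

Lemma deriv_cst a z : is_derive z (1 : R) (fun=> a) 0.
Proof. exact: is_derive_cst. Qed.

Lemma deriv_id z : is_derive z (1 : R) (fun x => x) 1.
Proof. exact: is_derive_id. Qed.

Lemma derivD f g z a b : is_derive z (1 : R) f a -> is_derive z (1 : R) g b ->
  is_derive z (1 : R) (fun x => f x + g x) (a + b).
Proof. by move=> *; exact: is_deriveD. Qed.

Lemma derivN f z a : is_derive z (1 : R) f a ->
  is_derive z (1 : R) (fun x => - f x) (- a).
Proof. by move=> *; exact: is_deriveN. Qed.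

Lemma derivM f g z a b : is_derive z (1 : R) f a -> is_derive z (1 : R) g b ->
  is_derive z (1 : R) (fun x => f x * g x) (f z * b + g z * a).
Proof. by move=> *; exact: is_deriveM. Qed.

Lemma derivX f n z a : is_derive z (1 : R) f a ->
  is_derive z (1 : R) (fun x => f x ^+ n) (n%:R * f z ^+ n.-1 * a).
Proof.
move=> fa; have := is_deriveX n fa; rewrite (_ : f ^+ n = fun x => f x ^+ n)//.
by apply/funext => x; rewrite fctE.
Qed.

Lemma deriv_comp f g z a b : is_derive (g z) (1 : R) f a ->
  is_derive z (1 : R) g b -> is_derive z (1 : R) (fun x => f (g x)) (a * b).
Proof.
move=> fa gb; have := @is_derive1_comp _ f g z a b fa gb.
by rewrite (_ : f \o g = fun x => f (g x)).
Qed.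

Lemma deriv_exp f z a : is_derive z (1 : R) f a ->
  is_derive z (1 : R) (fun x => expR (f x)) (expR (f z) * a).
Proof. by move=> fa; apply: deriv_comp. Qed.

Lemma deriv_eq f z a b : is_derive z (1 : R) f a -> a = b ->
  is_derive z (1 : R) f b.
Proof. by move=> ? <-. Qed.

Lemma deriv_continuous f z a : is_derive z (1 : R) f a -> {for z, continuous f}.
Proof.
move=> fa; apply: differentiable_continuous; apply/derivable1_diffP.
exact: ex_derive.
Qed.

Lemma derivE f z a : is_derive z (1 : R) f a -> derive1 f z = a.
Proof. by move=> fa; rewrite derive1E; exact: derive_val. Qed.

Lemma derivable_deriv f z : derivable f z 1 -> is_derive z (1 : R) f (derive1 f z).
Proof. by move=> df; rewrite derive1E; exact/derivableP. Qed.

End Calculus.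

(** Differentiates an expression by its syntax, using derivatives found among
    the hypotheses; the two [change] branches undo eta-contractions produced by
    unification. *)
Ltac der := lazymatch goal with
  | |- is_derive _ _ (fun _ => ?c) _ => apply: deriv_cst
  | |- is_derive _ _ (fun x => x) _ => apply: deriv_id
  | |- is_derive _ _ (fun x => _ + _) _ => eapply derivD; [der|der]
  | |- is_derive _ _ (fun x => - _) _ => eapply derivN; der
  | |- is_derive _ _ (fun x => _ * _) _ => eapply derivM; [der|der]
  | |- is_derive _ _ (fun x => _ ^+ _) _ => eapply derivX; der
  | |- is_derive _ _ (fun x => expR _) _ => eapply deriv_exp; der
  | |- is_derive ?z ?v -%R ?d => change (is_derive z v (fun x => - x) d); der
  | |- is_derive ?z ?v ( *%R ?c) ?d => change (is_derive z v (fun x => c * x) d); der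
  | _ => match goal with
         | H : _ |- _ => eapply H
         end
  end.
Ltac derive_by tac := eapply deriv_eq; [der|cbv beta; tac].

Section Comparison.
Variable R : realType.
Implicit Types (f g h : R -> R) (a b z : R).

Lemma MVT_deriv f (df : R -> R) a b : a <= b ->
  (forall z, a <= z <= b -> is_derive z (1 : R) f (df z)) ->
  exists2 x, a <= x <= b & f b - f a = df x * (b - a).
Proof.
move=> ab fd; have [||x xab ->] := @MVT_segment R f df a b ab.
- by move=> x; rewrite in_itv /= => /andP[? ?]; apply: fd; rewrite !ltW.
- apply: derivable_within_continuous => x; rewrite in_itv /= => xab.
  by have xd := fd _ xab; exact: ex_derive.
- by exists x => //; move: xab; rewrite in_itv.
Qed.

Lemma deriv_ge0_le f (df : R -> R) a b : a <= b ->
  (forall z, a <= z <= b -> is_derive z (1 : R) f (df z)) ->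
  (forall z, a <= z <= b -> 0 <= df z) -> f a <= f b.
Proof.
move=> ab fd df0; have [x xab e] := MVT_deriv ab fd.
by rewrite -subr_ge0 e mulr_ge0 ?df0 // subr_ge0.
Qed.

(** The hypothesis says that h e^(-K z) is nondecreasing.  This is Gronwall's
    inequality for h; K may have either sign, and both occur in the comparison
    arguments below. *)
Lemma linear_comparison (K L : R) h (dh : R -> R) :
  (forall z, is_derive z (1 : R) h (dh z)) ->
  (forall z, 0 <= z <= L -> K * h z <= dh z) -> 0 <= h 0 ->
  forall z, 0 <= z <= L -> 0 <= h z.
Proof.
move=> hd dhK h0 z /andP[z0 zL].
suff: 0 <= h z * expR (- K * z) by rewrite pmulr_lge0 // expR_gt0.
have /= := @deriv_ge0_le (fun x => h x * expR (- K * x))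
  (fun x => (dh x - K * h x) * expR (- K * x)) 0 z z0.
rewrite mulr0 expR0 mulr1 => le_h; apply: (le_trans h0); apply: le_h.
  by move=> x _; derive_by ltac:(ring).
move=> x /andP[x0 xz]; rewrite mulr_ge0 ?expR_ge0 // subr_ge0 dhK //.
by rewrite x0 (le_trans xz).
Qed.

(** The integral over [-M, x] is a primitive only to the right of -M, so the
    primitive on the whole line is glued from these as M grows with x. *)
Lemma primitive f : continuous f ->
  exists g, (forall z, is_derive z (1 : R) g (f z)) /\ g 0 = 0.
Proof.
move=> fc.
have H (M z : R) : - M < z -> is_derive z (1 : R)
    (fun x => \int[lebesgue_measure]_(t in `[- M, x]) f t) (f z).
  move=> Mz; have z1 : z < z + 1 by rewrite ltrDl.
  have int : lebesgue_measure.-integrable `[- M, z + 1] (EFin \o f).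
    apply: continuous_compact_integrable; first exact: segment_compact.
    exact: continuous_subspaceT.
  have [d1 d2] := @continuous_FTC1_closed R f (- M) z (z + 1) z1 int Mz (fc z).
  by rewrite -d2; exact: derivable_deriv.
pose J M x := \int[lebesgue_measure]_(t in `[- M, x]) f t
  - \int[lebesgue_measure]_(t in `[- M, 0]) f t.
have JH M z : - M < z -> is_derive z (1 : R) (J M) (f z).
  move=> Mz; rewrite /J; have := H _ _ Mz => {}H; derive_by ltac:(ring).
have J0 M : J M 0 = 0 by rewrite /J subrr.
have Jeq M N z : 0 < M -> M <= N -> - M < z -> J M z = J N z.
  move=> M0 MN Mz; have d x : - M < x -> is_derive x (1 : R) (fun x => J M x - J N x) 0.
    move=> Mx; have h1 := JH M x Mx; have h2 : is_derive x (1 : R) (J N) (f x).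
      by apply: JH; rewrite (le_lt_trans _ Mx) // lerN2.
    derive_by ltac:(by rewrite subrr).
  apply/eqP; rewrite -subr_eq0; apply/eqP.
  have [z0|z0] := leP 0 z.
    have [x|x _ /=] := @MVT_deriv (fun x => J M x - J N x) (fun=> 0) 0 z z0.
      by move=> /andP[x0 _]; apply: d; rewrite (lt_le_trans _ x0) // oppr_lt0.
    by rewrite !J0 mul0r !subr0.
  have [x|x _ /=] := @MVT_deriv (fun x => J M x - J N x) (fun=> 0) z 0 (ltW z0).
    by move=> /andP[x0 _]; apply: d; rewrite (lt_le_trans _ x0).
  by rewrite !J0 mul0r !subr0 sub0r => /eqP; rewrite oppr_eq0 => /eqP.
exists (fun z => J (`|z| + 1) z); split; last by rewrite J0.
move=> z; have zM : - (`|z| + 2) < z.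
  by rewrite ltrNl (le_lt_trans (ler_norm _)) // normrN ltrDl.
have := JH _ _ zM; apply: near_eq_is_derive.
have : \forall y \near z, `|y - z| < 1.
  by near=> y; rewrite distrC; near: y; exact: cvgr_dist_lt.
apply: filterS => y yz.
have H1 : `|y| <= `|z| + 1.
  have := ler_normD (y - z) z; rewrite subrK => /le_trans -> //.
  by rewrite addrC lerD2l ltW.
apply/esym/Jeq; first by rewrite ltr_wpDl.
  by rewrite (_ : 2 = 1 + 1) // addrA lerD2r.
by rewrite ltrNl (le_lt_trans (ler_norm _)) // normrN ltrDl.
Unshelve. all: by end_near. Qed.

End Comparison.

(** * Second-order systems with complex coefficients *)

Section ComplexSystem.
Variable R : realType.
Implicit Types (x y : R[i]) (a b z : R).

Definition sqn x : R := complex.Re x ^+ 2 + complex.Im x ^+ 2.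

Lemma ReD x y : complex.Re (x + y) = complex.Re x + complex.Re y.
Proof. by case: x y => [? ?] []. Qed.
Lemma ImD x y : complex.Im (x + y) = complex.Im x + complex.Im y.
Proof. by case: x y => [? ?] []. Qed.
Lemma ReN x : complex.Re (- x) = - complex.Re x. Proof. by case: x. Qed.
Lemma ImN x : complex.Im (- x) = - complex.Im x. Proof. by case: x. Qed.
Lemma ReM x y : complex.Re (x * y) =
  complex.Re x * complex.Re y - complex.Im x * complex.Im y.
Proof. by case: x y => [? ?] []. Qed.
Lemma ImM x y : complex.Im (x * y) =
  complex.Re x * complex.Im y + complex.Im x * complex.Re y.
Proof. by case: x y => [? ?] []. Qed.
Definition ReImE := (ReD, ImD, ReN, ImN, ReM, ImM).

Lemma complex_ext x y : complex.Re x = complex.Re y ->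
  complex.Im x = complex.Im y -> x = y.
Proof. by case: x y => [? ?] [? ?] /= -> ->. Qed.

Lemma sqn_ge0 x : 0 <= sqn x. Proof. by rewrite addr_ge0 ?sqr_ge0. Qed.

Lemma sqnM x y : sqn (x * y) = sqn x * sqn y.
Proof. by rewrite /sqn !ReImE; ring. Qed.

Lemma sqnX x n : sqn (x ^+ n) = sqn x ^+ n.
Proof.
by elim: n => [|n IH]; rewrite ?expr0 ?exprS ?sqnM ?IH //; rewrite /sqn /=; ring.
Qed.

Lemma sqnN x : sqn (- x) = sqn x. Proof. by rewrite /sqn !ReImE !sqrrN. Qed.

Lemma sqnR a : sqn a%:C = a ^+ 2. Proof. by rewrite /sqn /=; ring. Qed.

Lemma sqnD_le x y : sqn (x + y) <= 2 * sqn x + 2 * sqn y.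
Proof.
rewrite /sqn !ReImE -subr_ge0.
have := sqr_ge0 (complex.Re x - complex.Re y).
have := sqr_ge0 (complex.Im x - complex.Im y).
by nra.
Qed.

Lemma sqn_eq0 x : (sqn x == 0) = (x == 0).
Proof.
by case: x => a b; rewrite /sqn eq_complex /= paddr_eq0 ?sqr_ge0 // !sqrf_eq0.
Qed.

Lemma sqn0 : sqn 0 = 0. Proof. by apply/eqP; rewrite sqn_eq0. Qed.

Lemma sqn_le0 x : sqn x <= 0 -> x = 0.
Proof. by move=> x0; apply/eqP; rewrite -sqn_eq0 eq_le x0 sqn_ge0. Qed.

Lemma derivC_eq (h : R -> R[i]) z x y :
  is_deriveC h z x -> x = y -> is_deriveC h z y.
Proof. by move=> ? <-. Qed.

Lemma derivCD (h k : R -> R[i]) z x y : is_deriveC h z x -> is_deriveC k z y ->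
  is_deriveC (fun t => h t + k t) z (x + y).
Proof.
move=> [h1 h2] [k1 k2]; split.
  by under eq_fun do rewrite ReD; rewrite ReD; exact: derivD.
by under eq_fun do rewrite ImD; rewrite ImD; exact: derivD.
Qed.

Lemma derivCM (h k : R -> R[i]) z x y : is_deriveC h z x -> is_deriveC k z y ->
  is_deriveC (fun t => h t * k t) z (h z * y + k z * x).
Proof.
move=> [h1 h2] [k1 k2]; split.
  under eq_fun do rewrite ReM.
  by eapply deriv_eq; [der | cbv beta; rewrite !ReImE; ring].
under eq_fun do rewrite ImM.
by eapply deriv_eq; [der | cbv beta; rewrite !ReImE; ring].
Qed.

Lemma derivC_cst x z : is_deriveC (fun=> x) z 0.
Proof. by split; apply: deriv_cst. Qed.

Lemma derivCN (h : R -> R[i]) z x : is_deriveC h z x ->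
  is_deriveC (fun t => - h t) z (- x).
Proof.
move=> [h1 h2]; split.
  by under eq_fun do rewrite ReN; rewrite ReN; exact: derivN.
by under eq_fun do rewrite ImN; rewrite ImN; exact: derivN.
Qed.

Lemma derivC_real (h : R -> R) z a : is_derive z (1 : R) h a ->
  is_deriveC (fun t => (h t)%:C) z a%:C.
Proof. by move=> ha; split => //=; apply: deriv_cst. Qed.

Lemma derivC_sum (h dh : nat -> R -> R[i]) z n :
  (forall i, is_deriveC (h i) z (dh i z)) ->
  is_deriveC (fun t => \sum_(i < n) h i t) z (\sum_(i < n) dh i z).
Proof.
move=> hd; elim: n => [|n IH].
  by rewrite big_ord0; under eq_fun do rewrite big_ord0; exact: derivC_cst.
rewrite big_ord_recr /=; under eq_fun do rewrite big_ord_recr /=.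
exact: derivCD.
Qed.

(** Young's inequality on each cross term of the derivative of the energy, with
    A and B bounding the squared moduli of the two coefficients.  This is where
    the rate 4 + A + B comes from. *)
Lemma energy_derivative_bound (A B N th e a b c d r t p1 q1 p2 q2 : R) :
  a ^+ 2 + b ^+ 2 <= A -> c ^+ 2 + d ^+ 2 <= B ->
  r ^+ 2 + t ^+ 2 <= (th - (4 + A + B)) * N * e ->
  (4 + A + B) * (N * e - (p1 ^+ 2 + q1 ^+ 2 + (p2 ^+ 2 + q2 ^+ 2))) <=
  N * (th * e) - 2 * (p1 * p2 + q1 * q2 +
    (p2 * (a * p1 - b * q1 + (c * p2 - d * q2) + r) +
     q2 * (a * q1 + b * p1 + (c * q2 + d * p2) + t))).
Proof.
move=> ab cd rt.
have A0 : 0 <= A by apply: le_trans ab; rewrite addr_ge0 ?sqr_ge0.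
have B0 : 0 <= B by apply: le_trans cd; rewrite addr_ge0 ?sqr_ge0.
have := sqr_ge0 (p1 - p2); have := sqr_ge0 (q1 - q2).
have := sqr_ge0 (p2 - (a * p1 - b * q1)).
have := sqr_ge0 (q2 - (a * q1 + b * p1)).
have := sqr_ge0 (p2 - (c * p2 - d * q2)).
have := sqr_ge0 (q2 - (c * q2 + d * p2)).
have := sqr_ge0 (p2 - r); have := sqr_ge0 (q2 - t).
have : 0 <= (A - (a ^+ 2 + b ^+ 2)) * (p1 ^+ 2 + q1 ^+ 2).
  by rewrite mulr_ge0 ?subr_ge0 ?addr_ge0 ?sqr_ge0.
have : 0 <= (B - (c ^+ 2 + d ^+ 2)) * (p2 ^+ 2 + q2 ^+ 2).
  by rewrite mulr_ge0 ?subr_ge0 ?addr_ge0 ?sqr_ge0.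
have : 0 <= (3 + B) * (p1 ^+ 2 + q1 ^+ 2) by rewrite mulr_ge0 ?addr_ge0 ?sqr_ge0.
have : 0 <= A * (p2 ^+ 2 + q2 ^+ 2) by rewrite mulr_ge0 ?addr_ge0 ?sqr_ge0.
by lra.
Qed.

(** Gronwall's inequality for the energy.  The rate th is free: the forcing only
    has to satisfy M <= (th - (4 + A + B)) N, so a large th matches a given
    forcing with a small bound N on the solution. *)
Lemma energy_estimate (A B L M N th : R) (al : R -> R[i]) (be : R[i])
    (d1 d2 rho : R -> R[i]) :
  (forall z, is_deriveC d1 z (d2 z)) ->
  (forall z, is_deriveC d2 z (al z * d1 z + be * d2 z + rho z)) ->
  (forall z, sqn (al z) <= A) -> sqn be <= B ->
  (forall z, 0 <= z <= L -> sqn (rho z) <= M * expR (th * z)) ->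
  M <= (th - (4 + A + B)) * N -> sqn (d1 0) + sqn (d2 0) <= N ->
  forall z, 0 <= z <= L -> sqn (d1 z) + sqn (d2 z) <= N * expR (th * z).
Proof.
move=> D1 D2 alA beB rhoM MN eN z zL; rewrite -subr_ge0.
pose p1 z := complex.Re (d1 z); pose q1 z := complex.Im (d1 z).
pose p2 z := complex.Re (d2 z); pose q2 z := complex.Im (d2 z).
pose a z := complex.Re (al z); pose b z := complex.Im (al z).
pose r z := complex.Re (rho z); pose t z := complex.Im (rho z).
set c := complex.Re be; set d := complex.Im be.
pose dp2 z := a z * p1 z - b z * q1 z + (c * p2 z - d * q2 z) + r z.
pose dq2 z := a z * q1 z + b z * p1 z + (c * q2 z + d * p2 z) + t z.
have Dp1 (x : R) : is_derive x (1 : R) p1 (p2 x) by exact: (D1 x).1.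
have Dq1 (x : R) : is_derive x (1 : R) q1 (q2 x) by exact: (D1 x).2.
have Dp2 (x : R) : is_derive x (1 : R) p2 (dp2 x).
  by apply: deriv_eq (D2 x).1 _; rewrite !ReImE.
have Dq2 (x : R) : is_derive x (1 : R) q2 (dq2 x).
  by apply: deriv_eq (D2 x).2 _; rewrite !ReImE.
have := @linear_comparison R (4 + A + B) L
  (fun z => N * expR (th * z) -
    (p1 z ^+ 2 + q1 z ^+ 2 + (p2 z ^+ 2 + q2 z ^+ 2)))
  (fun z => N * (th * expR (th * z)) -
    2 * (p1 z * p2 z + q1 z * q2 z + (p2 z * dp2 z + q2 z * dq2 z))).
apply => //; last by rewrite mulr0 expR0 mulr1 subr_ge0.
  by move=> x; derive_by ltac:(ring).
move=> x xL.
have ab : a x ^+ 2 + b x ^+ 2 <= A by exact: alA.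
have cd : c ^+ 2 + d ^+ 2 <= B by exact: beB.
have rt : r x ^+ 2 + t x ^+ 2 <= (th - (4 + A + B)) * N * expR (th * x).
  by rewrite (le_trans (rhoM _ xL)) // ler_wpM2r // expR_ge0.
exact: energy_derivative_bound ab cd rt.
Qed.

(** Uniqueness on the whole line; the negative half-line is reached by the
    reflection z -> -z, which preserves the shape of the system. *)
Lemma system_uniq (A : R) (al : R -> R[i]) (be : R[i]) (d1 d2 : R -> R[i]) :
  (forall z, is_deriveC d1 z (d2 z)) ->
  (forall z, is_deriveC d2 z (al z * d1 z + be * d2 z)) ->
  (forall z, sqn (al z) <= A) -> d1 0 = 0 -> d2 0 = 0 ->
  forall z, d1 z = 0 /\ d2 z = 0.
Proof.
have pos (al' : R -> R[i]) (be' : R[i]) (e1 e2 : R -> R[i]) :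
    (forall z, is_deriveC e1 z (e2 z)) ->
    (forall z, is_deriveC e2 z (al' z * e1 z + be' * e2 z)) ->
    (forall z, sqn (al' z) <= A) -> e1 0 = 0 -> e2 0 = 0 ->
    forall z, 0 <= z -> e1 z = 0 /\ e2 z = 0.
  move=> D1 D2 alA e10 e20 z z0.
  have := @energy_estimate A (sqn be') z 0 0 (4 + A + sqn be') al' be' e1 e2 (fun=> 0)
    D1 _ alA (lexx _) _ _ _ z _.
  rewrite e10 e20 z0 lexx !mul0r subrr mul0r sqn0.
  rewrite addr0 => H; have {}H : sqn (e1 z) + sqn (e2 z) <= 0.
    by apply: H => // x *; rewrite ?addr0 ?mul0r.
  have := sqn_ge0 (e1 z); have := sqn_ge0 (e2 z) => h2 h1.
  by split; apply: sqn_le0; lra.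
move=> D1 D2 alA d10 d20 z; have [z0|z0] := leP 0 z; first exact: pos D1 D2 _ _ _ _ z0.
have refl (h : R -> R[i]) (dh : R -> R[i]) (x : R) : is_deriveC h (- x) (dh (- x)) ->
    is_deriveC (fun t => h (- t)) x (- dh (- x)).
  move=> [h1 h2]; split.
    apply: deriv_eq (deriv_comp h1 (derivN (deriv_id _))) _.
    by rewrite ReN; ring.
  apply: deriv_eq (deriv_comp h2 (derivN (deriv_id _))) _.
  by rewrite ImN; ring.
have [||||||] := @pos (fun x : R => al (- x)) (- be) (fun x : R => d1 (- x)) (fun x : R => - d2 (- x)) _ _ _ _ _ (- z).
- by move=> x; exact: refl.
- move=> x; apply: derivC_eq (derivCN (@refl d2 (fun x : R => al x * d1 x + be * d2 x) x (D2 _))) _.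
  by ring.
- by move=> x; exact: alA.
- by rewrite oppr0.
- by rewrite oppr0 d20 oppr0.
- by rewrite oppr_ge0 ltW.
by rewrite opprK => -> /eqP; rewrite oppr_eq0 => /eqP ->.
Qed.

End ComplexSystem.

(** * Taylor expansion of solutions in the spectral parameter *)

Section ParameterExpansion.
Variable R : realType.
Implicit Types (z : R) (l : R[i]).

(** Characterizes the Taylor coefficients of entire functions. *)
Definition decay (u : nat -> R) : Prop :=
  forall r, 1 <= r -> exists C, forall n, `|u n| * r ^+ n <= C.

Definition psum (u : nat -> R) (N : nat) (l : R[i]) : R[i] :=
  \sum_(n < N) (u n)%:C * l ^+ n.

(** Convergence of the partial sums at the rate 2^(-N); the rate is arbitrary,
    any geometric one serves for the passages to the limit. *)
Definition expands (u : nat -> R) (l g : R[i]) : Prop :=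
  exists C : R, forall N, sqn (g - psum u N l) <= C / 4 ^+ N.

(** The coefficient of l^n in l W(l), resp. l^2 W(l), when W(l) has the
    coefficients W 0, W 1, and so on. *)
Definition shift1 (W : nat -> R -> R) n : R -> R :=
  if n is m.+1 then W m else fun=> 0.
Definition shift2 (W : nat -> R -> R) n : R -> R := shift1 (shift1 W) n.

Lemma psum_shift1 (W : nat -> R -> R) z N l :
  psum (fun n => shift1 W n z) N l =
  l * psum (fun n => W n z) N l - (shift1 W N z)%:C * l ^+ N.
Proof.
apply/eqP; rewrite -subr_eq opprK; apply/eqP.
have -> : psum (fun n => shift1 W n z) N l + (shift1 W N z)%:C * l ^+ N =
    psum (fun n => shift1 W n z) N.+1 l by rewrite /psum big_ord_recr.
rewrite /psum big_ord_recl /= mul0r add0r mulr_sumr; apply: eq_bigr => i _ /=.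
by rewrite exprS mulrCA.
Qed.

Lemma psum_shift2 (W : nat -> R -> R) z N l :
  psum (fun n => shift2 W n z) N l =
  l ^+ 2 * psum (fun n => W n z) N l - (shift2 W N.+1 z)%:C * l ^+ N.+1
    - (shift2 W N z)%:C * l ^+ N.
Proof. by rewrite /shift2 !psum_shift1 /= (exprS _ N); ring. Qed.

Variables (q : R -> R) (Q a b : R).
Hypothesis q_bound : forall z, q z ^+ 2 <= Q.
Variables (phi1 phi2 psi1 psi2 : R -> R).
Hypotheses (phi1D : forall z, is_derive z (1 : R) phi1 (phi2 z))
  (phi2D : forall z, is_derive z (1 : R) phi2 (q z * phi1 z))
  (psi1D : forall z, is_derive z (1 : R) psi1 (psi2 z))
  (psi2D : forall z, is_derive z (1 : R) psi2 (q z * psi1 z))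
  (wronskian0 : phi1 0 * psi2 0 - phi2 0 * psi1 0 = 1).

Lemma wronskian z : phi1 z * psi2 z - phi2 z * psi1 z = 1.
Proof.
rewrite -wronskian0.
apply: (@is_derive_0_is_cst _ (fun z => phi1 z * psi2 z - phi2 z * psi1 z)).
by move=> x; derive_by ltac:(ring).
Qed.

(** Variation of constants: the Wronskian is 1, so no division is needed in the
    Green function phi(t) psi(z) - psi(t) phi(z). *)
Lemma forced_solution (r : R -> R) : continuous r -> exists u v : R -> R,
  [/\ forall z, is_derive z (1 : R) u (v z),
      forall z, is_derive z (1 : R) v (q z * u z + r z), u 0 = 0 & v 0 = 0].
Proof.
move=> rc.
have cM (h dh : R -> R) : (forall z, is_derive z (1 : R) h (dh z)) ->
    continuous (fun z => h z * r z).
  by move=> hd z; apply: cvgM; [exact: (deriv_continuous (hd z))|exact: rc].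
have [I [ID I0]] := primitive (cM _ _ phi1D).
have [J [JD J0]] := primitive (cM _ _ psi1D).
exists (fun z => psi1 z * I z - phi1 z * J z),
  (fun z => psi2 z * I z - phi2 z * J z); split.
- by move=> z; derive_by ltac:(ring).
- move=> z; derive_by ltac:(idtac).
  by rewrite -[X in _ = _ + X]mul1r -(wronskian z); ring.
- by rewrite I0 J0; ring.
- by rewrite I0 J0; ring.
Qed.

Variables (chi1 chi2 : R -> R).
Hypotheses (chi1D : forall z, is_derive z (1 : R) chi1 (chi2 z))
  (chi2D : forall z, is_derive z (1 : R) chi2 (q z * chi1 z)).

(** Comparing powers of l in w2' = (q + a l^2) w1 + b l w2: each coefficient
    solves the equation at l = 0, forced by the two preceding coefficients.  The
    iterated state keeps the last two of them. *)
Lemma coefficient_functions : exists U V : nat -> R -> R,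
  [/\ forall n z, is_derive z (1 : R) (U n) (V n z),
      forall n z, is_derive z (1 : R) (V n)
        (q z * U n z + (b * shift1 V n z + a * shift2 U n z)),
      U 0%N = chi1 /\ V 0%N = chi2 &
      forall n, U n.+1 0 = 0 /\ V n.+1 0 = 0].
Proof.
have /choice[S SP] : forall r : R -> R, exists uv : (R -> R) * (R -> R),
    continuous r -> [/\ forall z, is_derive z (1 : R) uv.1 (uv.2 z),
      forall z, is_derive z (1 : R) uv.2 (q z * uv.1 z + r z),
      uv.1 0 = 0 & uv.2 0 = 0].
  move=> r; have [/forced_solution[u [v uvP]]|nc] := pselect (continuous r).
    by exists (u, v).
  by exists (fun=> 0, fun=> 0).
pose next (s : (R -> R) * (R -> R) * (R -> R)) :=
  (S (fun z => b * s.1.2 z + a * s.2 z), s.1.1).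
pose st n := iter n next ((chi1, chi2), fun=> 0).
pose U n := (st n).1.1; pose V n := (st n).1.2.
have stE n : (st n).2 = shift1 U n by case: n.
have stS n : (st n.+1).1 = S (fun z => b * V n z + a * shift1 U n z).
  by rewrite -stE.
have key n : (forall z, is_derive z (1 : R) (U n) (V n z)) /\
    (forall z, is_derive z (1 : R) (V n)
        (q z * U n z + (b * shift1 V n z + a * shift2 U n z))) /\
    (n <> 0%N -> U n 0 = 0 /\ V n 0 = 0).
  elim/ltn_ind: n => -[_|n IH].
    by split=> //; split=> // z; rewrite /= !mulr0 !addr0; exact: chi2D.
  have c : continuous (fun z => b * V n z + a * shift1 U n z).
    have [_ [dV _]] := IH n (ltnSn _) => z.
    apply: cvgD; apply: cvgM; try exact: cvg_cst; first exact: (deriv_continuous (dV z)).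
    case: n IH dV => [|n] IH dV; first exact: cvg_cst.
    by have [dU _] := IH n (ltnW (ltnSn _)); exact: (deriv_continuous (dU z)).
  have [D1 D2 I1 I2] := SP _ c.
  by rewrite /U /V stS; split; [|split].
exists U, V; split=> //.
- by move=> n; have [] := key n.
- by move=> n; have [_ []] := key n.
- by move=> n; have [_ [_]] := key n.+1; exact.
Qed.

Variables (U V : nat -> R -> R).
Hypotheses (UD : forall n z, is_derive z (1 : R) (U n) (V n z))
  (VD : forall n z, is_derive z (1 : R) (V n)
        (q z * U n z + (b * shift1 V n z + a * shift2 U n z)))
  (UV0 : forall n, U n.+1 0 = 0 /\ V n.+1 0 = 0).

Lemma shift1_bound (W : nat -> R -> R) (P C e z : R) n : 0 < P -> 0 <= C * e ->
  (forall m, (m < n)%N -> W m z ^+ 2 <= C / P ^+ m * e) ->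
  shift1 W n z ^+ 2 <= P * C / P ^+ n * e.
Proof.
move=> P0 Ce; case: n => [|n] /= Wb.
  by rewrite expr0 divr1 expr0n /= -mulrA mulr_ge0 // ltW.
rewrite (le_trans (Wb n _)) // le_eqVlt exprS.
by rewrite -(mulrA P) invfM (mulrCA C) !mulrA divff ?mul1r ?eqxx // lt0r_neq0.
Qed.

(** Each shift of the index costs a factor P.  The energy estimate divides the
    forcing by th - 4 - Q, so a weight e^(th z) with th large in terms of P
    absorbs that cost, and the decay rate P is arbitrary. *)
Lemma coefficient_bound (P L : R) : 0 < P -> exists th C : R, 0 <= C /\
  forall n z, 0 <= z <= L ->
    U n z ^+ 2 + V n z ^+ 2 <= C / P ^+ n * expR (th * z).
Proof.
move=> P0; pose k := 2 * b ^+ 2 * P + 2 * a ^+ 2 * P ^+ 2.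
pose C := U 0 0 ^+ 2 + V 0 0 ^+ 2.
have C0 : 0 <= C by rewrite addr_ge0 ?sqr_ge0.
exists (4 + Q + k), C; split => //.
elim/ltn_ind => n IH z zL.
pose N := C / P ^+ n.
have N0 : 0 <= N by rewrite divr_ge0 // exprn_ge0 // ltW.
have D1 x : is_deriveC (fun z => (U n z)%:C) x (V n x)%:C by exact/derivC_real.
have D2 x : is_deriveC (fun z => (V n z)%:C) x ((q x)%:C * (U n x)%:C +
    0 * (V n x)%:C + (b * shift1 V n x + a * shift2 U n x)%:C).
  by rewrite mul0r addr0 -rmorphM -rmorphD; exact/derivC_real.
have := @energy_estimate R Q 0 L (k * N) N (4 + Q + k) _ _ _ _ _ D1 D2 _ _ _ _ _ z zL.
rewrite !sqnR; apply.
- by move=> x; rewrite sqnR.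
- by rewrite expr0n.
- move=> x xL; rewrite sqnR.
  set e := expR _; have e0 : 0 <= e by exact: expR_ge0.
  have Ce : 0 <= C * e by exact: mulr_ge0.
  have V1 : shift1 V n x ^+ 2 <= P * C / P ^+ n * e.
    apply: shift1_bound => // m mn; have := IH m mn x xL.
    by apply: le_trans; rewrite lerDr sqr_ge0.
  have U2 : shift2 U n x ^+ 2 <= P * (P * C) / P ^+ n * e.
    apply: shift1_bound => [//||m mn]; first by rewrite -mulrA mulr_ge0 // ltW.
    apply: shift1_bound => // j jm.
    have := IH j (ltn_trans jm mn) x xL.
    by apply: le_trans; rewrite lerDl sqr_ge0.
  have -> : k * N * e = 2 * b ^+ 2 * (P * C / P ^+ n * e) +
     2 * a ^+ 2 * (P * (P * C) / P ^+ n * e) by rewrite /k /N; ring.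
  have := ler_wpM2l (mulr_ge0 (ler0n R 2) (sqr_ge0 b)) V1.
  have := ler_wpM2l (mulr_ge0 (ler0n R 2) (sqr_ge0 a)) U2.
  have := sqr_ge0 (b * shift1 V n x - a * shift2 U n x).
  by move: (_ / _ * e) (_ / _ * e) => ? ?; lra.
- by rewrite addr0 addrAC subrr add0r.
- rewrite /N; case: (n) => [|m]; first by rewrite expr0 divr1.
  by have [-> ->] := UV0 m; rewrite expr0n addr0 divr_ge0 // exprn_ge0 // ltW.
Qed.

Lemma tail4 (x : R) n : 0 <= x -> x / 4 ^+ n.+1 <= x / 4 ^+ n.
Proof.
move=> x0; rewrite ler_wpM2l // lef_pV2 ?posrE ?exprn_gt0 //.
by rewrite ler_eXn2l // ?ltr1n.
Qed.

Lemma coefficient_decay (L : R) : 0 <= L ->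
  decay (fun n => U n L) /\ decay (fun n => V n L).
Proof.
move=> L0.
suff H r : 1 <= r -> exists C, forall n,
    `|U n L| * r ^+ n <= C /\ `|V n L| * r ^+ n <= C.
  by split=> r /H[C HC]; exists C => n; have [] := HC n.
move=> r1; have r0 : 0 < r by rewrite (lt_le_trans ltr01).
have [th [C [C0 HC]]] := coefficient_bound L (exprn_gt0 2 r0).
have Ce : 0 <= C * expR (th * L) by rewrite mulr_ge0 ?expR_ge0.
exists (C * expR (th * L) + 1) => n.
have := HC n L; rewrite L0 lexx => /(_ isT) {}HC.
have s (x y : R) : x ^+ 2 + y ^+ 2 <= C / (r ^+ 2) ^+ n * expR (th * L) ->
    `|x| * r ^+ n <= C * expR (th * L) + 1.
  move=> xy; suff: (`|x| * r ^+ n) ^+ 2 <= C * expR (th * L).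
    set t := _ * _; have := sqr_ge0 (t - 1); nra.
  rewrite exprMn real_normK ?num_real // -exprM mulnC exprM.
  rewrite -ler_pdivlMr ?exprn_gt0 //.
  rewrite mulrAC; apply: le_trans xy; rewrite lerDl sqr_ge0 //.
by split; [exact: s HC|apply: s; rewrite addrC; exact: HC].
Qed.

Lemma psum_deriv (W dW : nat -> R -> R) l N z :
  (forall n z, is_derive z (1 : R) (W n) (dW n z)) ->
  is_deriveC (fun z => psum (W ^~ z) N l) z (psum (dW ^~ z) N l).
Proof.
move=> WD; apply: derivC_sum (fun n z => (W n z)%:C * l ^+ n)
  (fun n z => (dW n z)%:C * l ^+ n) _ _ _ => n.
apply: derivC_eq (derivCM (derivC_real (WD n z)) (derivC_cst _ _)) _.
by rewrite mulr0 add0r mulrC.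
Qed.

Lemma psumD (u v : nat -> R) (x y : R) N l :
  psum (fun n => x * u n + y * v n) N l = x%:C * psum u N l + y%:C * psum v N l.
Proof.
rewrite /psum !mulr_sumr -big_split; apply: eq_bigr => i _ /=.
by rewrite rmorphD !rmorphM /=; ring.
Qed.

(** The partial sums solve the system up to a forcing term that involves only
    the last coefficients, so the energy estimate bounds the remainder; no
    termwise differentiation is needed. *)
Lemma solution_expands (L : R) (l : R[i]) (w1 w2 : R -> R[i]) : 0 <= L ->
  (forall z, is_deriveC w1 z (w2 z)) ->
  (forall z, is_deriveC w2 z
    (((q z)%:C + a%:C * l ^+ 2) * w1 z + b%:C * l * w2 z)) ->
  w1 0 = (U 0%N 0)%:C -> w2 0 = (V 0%N 0)%:C ->
  expands (fun n => U n L) l (w1 L) /\ expands (fun n => V n L) l (w2 L).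
Proof.
move=> L0 D1 D2 w10 w20.
pose s := sqn l + 1.
have s0 : 0 < s by rewrite ltr_wpDl ?sqn_ge0.
(* The squares of the coefficients decay like (4 s)^(-n) with s > |l|^2, which
   leaves 4^(-N) after multiplication by |l|^(2N). *)
have P0 : 0 < 4 * s by rewrite mulr_gt0.
have [th [C [C0 HC]]] := coefficient_bound L P0.
pose P := 4 * s.
pose A := 2 * Q + 2 * (a ^+ 2 * sqn l ^+ 2); pose B := b ^+ 2 * sqn l.
pose th' := `|th| + (4 + A + B) + 1.
(* k collects the constants of the three forcing terms in rho; the summand 1
   covers the initial energy when the partial sum is empty. *)
pose k := 4 * b ^+ 2 * P + 6 * a ^+ 2 * P ^+ 2 + 1.
have Q0 : 0 <= Q by apply: le_trans (q_bound 0); exact: sqr_ge0.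
have AB : 0 <= 4 + A + B.
  apply: addr_ge0; last exact: mulr_ge0 (sqr_ge0 _) (sqn_ge0 _).
  apply: addr_ge0 => //; apply: addr_ge0; apply: mulr_ge0 => //.
  exact: mulr_ge0 (sqr_ge0 _) (sqr_ge0 _).
have k1 : 1 <= k.
  rewrite /k lerDr.
  apply: addr_ge0; last by apply: mulr_ge0 (sqr_ge0 _); exact: mulr_ge0 (sqr_ge0 _).
  by apply: mulr_ge0 (ltW P0); exact: mulr_ge0 (sqr_ge0 _).
have k0 : 0 <= k by rewrite (le_trans ler01).
suff H N : sqn (w1 L - psum (fun n => U n L) N l) +
    sqn (w2 L - psum (fun n => V n L) N l) <= k * C * expR (th' * L) / 4 ^+ N.
  split; exists (k * C * expR (th' * L)) => N; apply: le_trans (H N);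
  by rewrite ?lerDl ?lerDr sqn_ge0.
pose rho z := (b * shift1 V N z)%:C * l ^+ N + (a * shift2 U N z)%:C * l ^+ N
  + (a * shift2 U N.+1 z)%:C * l ^+ N.+1.
have E1 z : is_deriveC (fun z => w1 z - psum (U ^~ z) N l) z
    (w2 z - psum (V ^~ z) N l).
  exact: derivCD (D1 z) (derivCN (psum_deriv l N z UD)).
have E2 z : is_deriveC (fun z => w2 z - psum (V ^~ z) N l) z
    (((q z)%:C + a%:C * l ^+ 2) * (w1 z - psum (U ^~ z) N l) +
     b%:C * l * (w2 z - psum (V ^~ z) N l) + rho z).
  apply: derivC_eq (derivCD (D2 z) (derivCN (psum_deriv l N z VD))) _.
  have -> : psum (fun n => q z * U n z + (b * shift1 V n z + a * shift2 U n z)) N l =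
    (q z)%:C * psum (U ^~ z) N l + (b%:C * psum (fun n => shift1 V n z) N l +
      a%:C * psum (fun n => shift2 U n z) N l).
    rewrite -psumD /psum mulr_sumr -big_split; apply: eq_bigr => i _ /=.
    by rewrite rmorphD rmorphM /=; ring.
  by rewrite psum_shift1 psum_shift2 /rho !rmorphM /=; ring.
have := @energy_estimate R A B L (k * C / 4 ^+ N) (k * C / 4 ^+ N) th' _ _ _ _ _
  E1 E2 _ _ _ _ _ L.
rewrite L0 lexx => H; apply: le_trans (H _ _ _ _ _ isT) _; last by rewrite mulrAC.
- move=> z; rewrite (le_trans (sqnD_le _ _)) // lerD //.
    by rewrite ler_wpM2l // sqnR.
  by rewrite sqnM sqnX sqnR.
- by rewrite sqnM sqnR.
- move=> z zL; have [z0 zL'] := andP zL.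
  set e := expR (th * z); have e0 : 0 <= e by exact: expR_ge0.
  have ee : e <= expR (th' * z).
    rewrite ler_expR ler_wpM2r // /th' -addrA.
    by rewrite (le_trans (ler_norm _)) // lerDl addr_ge0.
  have Ce : 0 <= C * e by exact: mulr_ge0.
  have V1 n : shift1 V n z ^+ 2 <= P * C / P ^+ n * e.
    apply: shift1_bound => // m mn; have := HC m z zL.
    by apply: le_trans; rewrite lerDr sqr_ge0.
  have U2 n : shift2 U n z ^+ 2 <= P * (P * C) / P ^+ n * e.
    apply: shift1_bound => [//||m mn]; first by rewrite -mulrA mulr_ge0 // ltW.
    apply: shift1_bound => // j jm.
    have := HC j z zL.
    by apply: le_trans; rewrite lerDl sqr_ge0.
  have ls n : sqn l ^+ n / P ^+ n <= 1 / 4 ^+ n.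
    rewrite /P exprMn invfM mulrCA mul1r ler_piMr ?invr_ge0 ?exprn_ge0 //.
    rewrite -expr_div_n exprn_ile1 // ?divr_ge0 ?sqn_ge0 ?(ltW s0) //.
    by rewrite ler_pdivrMr // mul1r lerDl.
  have T (c x y : R) n : 0 <= y -> x ^+ 2 <= y / P ^+ n * e ->
      sqn ((c * x)%:C * l ^+ n) <= c ^+ 2 * (y * e) / 4 ^+ n.
    move=> y0 xy; rewrite sqnM sqnX sqnR exprMn.
    apply: (@le_trans _ _ (c ^+ 2 * (y / P ^+ n * e) * sqn l ^+ n)).
      by rewrite ler_wpM2r ?exprn_ge0 ?sqn_ge0 // ler_wpM2l ?sqr_ge0.
    have -> : c ^+ 2 * (y / P ^+ n * e) * sqn l ^+ n =
      c ^+ 2 * (y * e) * (sqn l ^+ n / P ^+ n) by ring.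
    rewrite -[X in _ <= X / _]mulr1 -[leRHS]mulrA ler_wpM2l //.
    exact: mulr_ge0 (sqr_ge0 _) (mulr_ge0 y0 e0).
  have PC := mulr_ge0 (ltW P0) C0.
  have t1 := T b _ _ N PC (V1 N).
  have t2 := T a _ _ N (mulr_ge0 (ltW P0) PC) (U2 N).
  have t3 := T a _ _ N.+1 (mulr_ge0 (ltW P0) PC) (U2 N.+1).
  have {}t3 := le_trans t3 (tail4 N (mulr_ge0 (sqr_ge0 a)
    (mulr_ge0 (mulr_ge0 (ltW P0) PC) e0))).
  have := sqnD_le ((b * shift1 V N z)%:C * l ^+ N + (a * shift2 U N z)%:C * l ^+ N)
    ((a * shift2 U N.+1 z)%:C * l ^+ N.+1).
  have := sqnD_le ((b * shift1 V N z)%:C * l ^+ N) ((a * shift2 U N z)%:C * l ^+ N).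
  rewrite -/(rho z) => r1 r2.
  have kC : 0 <= k * C / 4 ^+ N by rewrite divr_ge0 ?exprn_ge0 // mulr_ge0.
  apply: le_trans (ler_wpM2l kC ee).
  have -> : k * C / 4 ^+ N * e = 4 * (b ^+ 2 * (P * C * e) / 4 ^+ N) +
    4 * (a ^+ 2 * (P * (P * C) * e) / 4 ^+ N) +
    2 * (a ^+ 2 * (P * (P * C) * e) / 4 ^+ N) + C * e / 4 ^+ N by rewrite /k; ring.
  have : 0 <= C * e / 4 ^+ N by rewrite divr_ge0 ?exprn_ge0.
  rewrite -/P in t1 t2 t3.
  by lra.
- have X0 : 0 <= k * C / 4 ^+ N by rewrite divr_ge0 ?exprn_ge0 // mulr_ge0.
  by rewrite -[leLHS]mul1r ler_wpM2r // /th'; have := normr_ge0 th; lra.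
- case: N {rho E1 E2 H} => [|N].
    rewrite /psum !big_ord0 !subr0 w10 w20 !sqnR expr0 divr1.
    have := HC 0%N 0; rewrite lexx L0 => /(_ isT).
    rewrite mulr0 expR0 mulr1 expr0 divr1 => /le_trans; apply.
    by rewrite -[leLHS]mul1r ler_wpM2r.
  have S u : (forall n, u n.+1 = 0) -> psum u N.+1 l = (u 0%N)%:C.
    move=> u0; rewrite /psum big_ord_recl /= expr0 mulr1 big1 ?addr0 // => i _.
    by rewrite u0 mul0r.
  rewrite !S ?w10 ?w20 ?subrr ?sqn0; try by move=> n; have [] := UV0 n.
  by rewrite addr0 divr_ge0 ?exprn_ge0 // mulr_ge0.
Qed.

End ParameterExpansion.

(** The sequences u and v are chosen before l: the components at L of the
    solution with given initial values are entire in l.  They are real because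
    the solutions at l = 0 on which the recursion is based are real. *)
Lemma entire_dependence (R : realType) (q : R -> R) (Q a b L : R)
    (phi1 phi2 psi1 psi2 chi1 chi2 : R -> R) :
  (forall z, q z ^+ 2 <= Q) ->
  (forall z, is_derive z (1 : R) phi1 (phi2 z)) ->
  (forall z, is_derive z (1 : R) phi2 (q z * phi1 z)) ->
  (forall z, is_derive z (1 : R) psi1 (psi2 z)) ->
  (forall z, is_derive z (1 : R) psi2 (q z * psi1 z)) ->
  phi1 0 * psi2 0 - phi2 0 * psi1 0 = 1 ->
  (forall z, is_derive z (1 : R) chi1 (chi2 z)) ->
  (forall z, is_derive z (1 : R) chi2 (q z * chi1 z)) -> 0 <= L ->
  exists u v : nat -> R, [/\ decay u, decay v &
    forall (l : R[i]) (w1 w2 : R -> R[i]),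
    (forall z, is_deriveC w1 z (w2 z)) ->
    (forall z, is_deriveC w2 z
      (((q z)%:C + a%:C * l ^+ 2) * w1 z + b%:C * l * w2 z)) ->
    w1 0 = (chi1 0)%:C -> w2 0 = (chi2 0)%:C ->
    expands u l (w1 L) /\ expands v l (w2 L)].
Proof.
move=> qQ p1 p2 s1 s2 W c1 c2 L0.
have [U [V [UD VD [U0 V0] UV0]]] := coefficient_functions a b p1 p2 s1 s2 W c1 c2.
have [du dv] := coefficient_decay qQ UD VD UV0 L0.
exists (U ^~ L), (V ^~ L); split => // l w1 w2 D1 D2 w10 w20.
by apply: (solution_expands qQ UD VD UV0 L0 D1 D2); rewrite ?U0 ?V0.
Qed.

(** * Entire series with real coefficients *)

Section EntireSeries.
Variable R : realType.
Implicit Types (a u x : nat -> R) (l h g : R[i]).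

Definition psumR a (t : R) : R := limn (pseries a t).

(** The sum is defined through its real and imaginary parts, whose limits are
    taken in the reals; the codomain carries the normed structure for which
    complex derivatives are taken. *)
Definition psumC a l : R[i]^o :=
  (limn (series (fun n => complex.Re ((a n)%:C * l ^+ n)))) +i*
  (limn (series (fun n => complex.Im ((a n)%:C * l ^+ n)))).

Lemma geometric_tail x (C : R) : (forall n, `|x n| <= C / 2 ^+ n) ->
  cvgn (series x) /\ forall N, `|limn (series x) - series x N| <= 2 * C / 2 ^+ N.
Proof.
move=> xC; have C0 : 0 <= C.
  by have := xC 0%N; rewrite expr0 divr1; apply: le_trans.
have cx : cvgn (series x).
  apply: normed_cvg; apply: (@series_le_cvg _ _ (geometric C 2^-1)) => [n|n|n|].
  - exact: normr_ge0.
  - by rewrite /= mulr_ge0 ?exprn_ge0 ?invr_ge0.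
  - by rewrite /= exprVn; exact: xC.
  - apply: is_cvg_geometric_series; rewrite ger0_norm ?invr_ge0 //.
    by rewrite invf_lt1 // ltr1n.
split=> // N.
have H M : `|series x (N + M)%N - series x N| <= 2 * C / 2 ^+ N - 2 * C / 2 ^+ (N + M).
  elim: M => [|M IH]; first by rewrite addn0 !subrr normr0.
  rewrite addnS /series /= big_nat_recr //= -/(series x (N + M)%N).
  rewrite addrAC (le_trans (ler_normD _ _)) //.
  have h : 2 * C / 2 ^+ (N + M).+1 = C / 2 ^+ (N + M).
    by rewrite exprS invfM mulrACA divff ?mul1r.
  have := xC (N + M)%N; rewrite h.
  move: IH; have -> : 2 * C / 2 ^+ (N + M) = C / 2 ^+ (N + M) + C / 2 ^+ (N + M) by ring.
  by rewrite /series /=; lra.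
have cl : (fun M => `|series x M - series x N|) @ \oo --> `|limn (series x) - series x N|.
  by apply: cvg_norm; apply: cvgB => //; exact: cvg_cst.
rewrite -(cvg_lim _ cl) //; apply: limr_le; first by apply/cvg_ex; eexists; exact: cl.
near=> M; have NM : (N <= M)%N by near: M; exact: nbhs_infty_ge.
rewrite -(subnKC NM) (le_trans (H _)) // gerBl.
by rewrite divr_ge0 ?exprn_ge0 // mulr_ge0.
Unshelve. all: by end_near. Qed.

Lemma decay_diffs a : decay a -> decay (pseries_diffs a).
Proof.
move=> da r r1; have r0 : 0 < r by rewrite (lt_le_trans ltr01).
have [|C HC] := da (2 * r); first by lra.
exists C => n; apply: le_trans (HC n.+1).
rewrite /pseries_diffs normrM ger0_norm // mulrAC mulrC ler_wpM2l //.
rewrite exprMn ler_pM ?exprn_ge0 // ?(ltW r0) //; last by rewrite ler_weXn2l.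
by rewrite -natrX ler_nat ltnW // ltn_expl.
Qed.

Lemma sqn_expn_le l n : sqn l ^+ n <= ((sqn l + 1) ^+ n) ^+ 2.
Proof.
rewrite -exprM mulnC exprM lerXn2r ?qualifE /= ?sqn_ge0 ?sqr_ge0 //.
by have := sqn_ge0 l; nra.
Qed.

Lemma term_bound a l : decay a -> exists C, forall n,
  `|complex.Re ((a n)%:C * l ^+ n)| <= C / 2 ^+ n /\
  `|complex.Im ((a n)%:C * l ^+ n)| <= C / 2 ^+ n.
Proof.
move=> da; set s := sqn l + 1.
have s1 : 1 <= s by rewrite lerDr sqn_ge0.
have [|C HC] := da (2 * s); first by lra.
exists C => n.
have H t : t ^+ 2 <= sqn ((a n)%:C * l ^+ n) -> `|t| <= C / 2 ^+ n.
  move=> tn; apply: (@le_trans _ _ (`|a n| * s ^+ n)); last first.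
    by rewrite ler_pdivlMr ?exprn_gt0 // -mulrA -exprMn (mulrC s); exact: HC.
  rewrite -ler_sqr ?nnegrE ?mulr_ge0 ?exprn_ge0 // ?(le_trans _ s1) //.
  rewrite real_normK ?num_real // exprMn real_normK ?num_real //.
  by rewrite (le_trans tn) // sqnM sqnR sqnX ler_wpM2l ?sqr_ge0 // sqn_expn_le.
by split; apply: H; rewrite /sqn ?lerDl ?lerDr sqr_ge0.
Qed.

Lemma psum_Re a N l : complex.Re (psum a N l) =
  series (fun n => complex.Re ((a n)%:C * l ^+ n)) N.
Proof.
rewrite /psum /series /= big_mkord.
by elim: N => [|N IH]; rewrite ?big_ord0 // !big_ord_recr /= -IH ReD.
Qed.

Lemma psum_Im a N l : complex.Im (psum a N l) =
  series (fun n => complex.Im ((a n)%:C * l ^+ n)) N.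
Proof.
rewrite /psum /series /= big_mkord.
by elim: N => [|N IH]; rewrite ?big_ord0 // !big_ord_recr /= -IH ImD.
Qed.

Lemma psumC_expands a l : decay a -> expands a l (psumC a l).
Proof.
move=> da; have [C HC] := term_bound l da.
have [_ H1] := geometric_tail (fun n => (HC n).1).
have [_ H2] := geometric_tail (fun n => (HC n).2).
exists (2 * (2 * C) ^+ 2) => N.
rewrite /sqn !ReD !ImD ReN ImN psum_Re psum_Im /=.
have four : (4 : R) ^+ N = (2 ^+ N) ^+ 2 by rewrite -!natrX -expnM mulnC expnM.
have K (t : R) : `|t| <= 2 * C / 2 ^+ N -> t ^+ 2 <= (2 * C) ^+ 2 / 4 ^+ N.
  move=> tC; rewrite -(real_normK (num_real t)) four -expr_div_n.
  by rewrite lerXn2r ?qualifE /= ?(le_trans _ tC).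
by have := K _ (H1 N); have := K _ (H2 N); lra.
Qed.

Lemma le0_of_geometric (y C : R) : (forall N, y <= C / 4 ^+ N) -> y <= 0.
Proof.
move=> yC; have cl : (fun N => C / 4 ^+ N) @ \oo --> 0.
  have := @cvg_geometric R C 4^-1; rewrite ger0_norm ?invr_ge0 // invf_lt1 // ltr1n.
  move=> /(_ isT); rewrite (_ : geometric C 4^-1 = fun N => C / 4 ^+ N) //.
  by apply/funext => n; rewrite /= exprVn.
rewrite -(cvg_lim _ cl) //; apply: limr_ge; first by apply/cvg_ex; eexists; exact: cl.
by near=> N; exact: yC.
Unshelve. all: by end_near. Qed.

Lemma expands_uniq a l g g' : expands a l g -> expands a l g' -> g = g'.
Proof.
move=> [C HC] [C' HC']; apply/eqP; rewrite -subr_eq0 -sqn_eq0 eq_le sqn_ge0 andbT.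
apply: (@le0_of_geometric _ (2 * C + 2 * C')) => N.
have -> : g - g' = (g - psum a N l) + - (g' - psum a N l) by ring.
apply: le_trans (sqnD_le _ _) _; rewrite sqnN.
by have := HC N; have := HC' N; lra.
Qed.

Lemma normc_sqn (y : R[i]) (e : R) : 0 <= e -> (`|y| <= e%:C) = (sqn y <= e ^+ 2).
Proof.
move=> e0; rewrite normc_def lecR -/(sqn y).
rewrite -[RHS](@ler_sqrt R) ?sqr_ge0 // sqrtr_sqr ger0_norm //.
Qed.

Lemma normc_sqn_lt (y : R[i]) (e : R) : 0 < e -> (`|y| < e%:C) = (sqn y < e ^+ 2).
Proof.
move=> e0; rewrite normc_def ltcR -/(sqn y).
by rewrite -[RHS](@ltr_sqrt R) ?exprn_gt0 // sqrtr_sqr gtr0_norm.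
Qed.

(** By induction: the remainder at n + 1 is y + h times the remainder at n plus
    a multiple of h^2 y^n. *)
Lemma monomial_remainder (F : numDomainType) (y h K : F) n : 1 <= K ->
  `|y| <= K -> `|y + h| <= K ->
  `|(y + h) ^+ n.+1 - y ^+ n.+1 - n.+1%:R * h * y ^+ n| <=
    n.+1%:R ^+ 2 * K ^+ n.+1 * `|h| ^+ 2.
Proof.
move=> K1 yK yhK; have K0 : 0 <= K by rewrite (le_trans _ K1).
elim: n => [|n IH].
  have -> : (y + h) ^+ 1 - y ^+ 1 - 1%:R * h * y ^+ 0 = 0 by ring.
  rewrite normr0.
  by rewrite !mulr_ge0 ?exprn_ge0.
have -> : (y + h) ^+ n.+2 - y ^+ n.+2 - n.+2%:R * h * y ^+ n.+1 =
  (y + h) * ((y + h) ^+ n.+1 - y ^+ n.+1 - n.+1%:R * h * y ^+ n) +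
  n.+1%:R * (h ^+ 2 * y ^+ n).
  rewrite (exprS _ n.+1) (exprS y n.+1) (exprS y n) -[in LHS]natr1; ring.
apply: le_trans (ler_normD _ _) _.
rewrite (normrM (y + h)) (normrM n.+1%:R) (normrM (h ^+ 2)) 2!normrX normr_nat.
apply: (@le_trans _ _ (K * (n.+1%:R ^+ 2 * K ^+ n.+1 * `|h| ^+ 2) +
   n.+1%:R * (`|h| ^+ 2 * K ^+ n.+2))).
  apply: lerD; first exact: ler_pM.
  rewrite ler_wpM2l // ler_wpM2l ?exprn_ge0 //.
  rewrite (@le_trans _ _ (K ^+ n)) ?lerXn2r ?qualifE //=.
  by rewrite ler_weXn2l // leqW.
have -> : K * (n.+1%:R ^+ 2 * K ^+ n.+1 * `|h| ^+ 2) + n.+1%:R * (`|h| ^+ 2 * K ^+ n.+2)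
  = (n.+1%:R ^+ 2 + n.+1%:R) * K ^+ n.+2 * `|h| ^+ 2 by rewrite (exprS K n.+1); ring.
rewrite ler_wpM2r ?exprn_ge0 // ler_wpM2r ?exprn_ge0 //.
by rewrite -!natrX -natrD ler_nat -!mulnn -mulnSr leq_mul2r leqnSn orbT.
Qed.

Lemma psum_remainder a l N h : psum a N.+1 (l + h) - psum a N.+1 l -
    h * psum (pseries_diffs a) N l =
  \sum_(n < N) (a n.+1)%:C * ((l + h) ^+ n.+1 - l ^+ n.+1 - n.+1%:R * h * l ^+ n).
Proof.
rewrite /psum !(big_ord_recl N) /= !expr0 mulr_sumr opprD addrACA subrr add0r.
rewrite -sumrB -sumrB; apply: eq_bigr => i _; rewrite /= /bump /= add1n.
by rewrite /pseries_diffs rmorphM rmorph_nat; ring.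
Qed.

Lemma sq_mul_pow2_le n : (n ^ 2 * 2 ^ n <= 8 ^ n)%N.
Proof.
rewrite -[8%N]/(4 * 2)%N expnMn leq_mul2r -[4%N]/(2 ^ 2)%N -expnM mulnC expnM.
by rewrite leq_exp2r // ltnW ?orbT // ltn_expl.
Qed.

(** The estimate holds for partial sums with a constant that does not depend on
    the number of terms, because the coefficients outweigh n^2 K^n; it then
    passes to the limit. *)
Lemma psumC_remainder a l : decay a -> exists C, forall h, sqn h <= 1 ->
  sqn (psumC a (l + h) - psumC a l - h * psumC (pseries_diffs a) l) <=
  C * sqn h ^+ 2.
Proof.
(* K bounds |l| and |l + h| when |h| <= 1. *)
move=> da; pose K := sqn l + 3.
have K1 : 1 <= K by have := sqn_ge0 l; rewrite /K; lra.
have K0 : 0 <= K by rewrite (le_trans _ K1).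
have [|C HC] := da (8 * K); first by lra.
have C0 : 0 <= C by apply: le_trans (HC 0%N); rewrite mulr_ge0.
exists (2 * C ^+ 2) => h h1.
have lK : `|l| <= K%:C.
  by rewrite normc_sqn // /K; have := sqn_ge0 l; nra.
have lhK : `|l + h| <= K%:C.
  by rewrite normc_sqn // (le_trans (sqnD_le _ _)) // /K; have := sqn_ge0 l; nra.
have H N : sqn (psum a N.+1 (l + h) - psum a N.+1 l -
    h * psum (pseries_diffs a) N l) <= (C * sqn h) ^+ 2.
  rewrite psum_remainder -normc_sqn ?mulr_ge0 ?sqn_ge0 //.
  have -> : (C * sqn h)%:C = C%:C * `|h| ^+ 2.
    by rewrite rmorphM -add_Re2_Im2.
  apply: le_trans (ler_norm_sum _ _ _) _.
  apply: (@le_trans _ _ (\sum_(n < N) (C / 2 ^+ n.+1)%:C * `|h| ^+ 2)).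
    apply: ler_sum => n _; rewrite normrM.
    apply: (@le_trans _ _ (`|(a n.+1)%:C| *
        (n.+1%:R ^+ 2 * K%:C ^+ n.+1 * `|h| ^+ 2))).
      by rewrite ler_wpM2l // monomial_remainder // lecR.
    rewrite mulrA ler_wpM2r ?exprn_ge0 //.
    rewrite (_ : `|(a n.+1)%:C| = `|a n.+1|%:C); last first.
      by rewrite normc_def /= expr0n addr0 sqrtr_sqr.
    have -> : (n.+1%:R : R[i]) = (n.+1%:R : R)%:C by rewrite rmorph_nat.
    rewrite -!rmorphXn -!rmorphM lecR.
    rewrite ler_pdivlMr ?exprn_gt0 //.
    apply: le_trans (HC n.+1); rewrite -mulrA ler_wpM2l // mulrAC.
    rewrite exprMn ler_wpM2r ?exprn_ge0 // -!natrX -natrM ler_nat.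
    exact: sq_mul_pow2_le.
    by rewrite ltr0n expn_gt0.
  have -> : \sum_(n < N) (C / 2 ^+ n.+1)%:C * `|h| ^+ 2 =
      (\sum_(n < N) C / 2 ^+ n.+1)%:C * `|h| ^+ 2.
    by rewrite rmorph_sum /= mulr_suml.
  rewrite ler_wpM2r ?exprn_ge0 // lecR.
  have -> : \sum_(i < N) C / 2 ^+ i.+1 = C - C / 2 ^+ N.
    elim: N => [|N IH]; first by rewrite big_ord0 expr0 divr1 subrr.
    rewrite big_ord_recr /= IH exprS invfM; lra.
  by rewrite gerBl divr_ge0 ?exprn_ge0.
have [C1 H1] := psumC_expands (l + h) da.
have [C2 H2] := psumC_expands l da.
have [C3 H3] := psumC_expands l (decay_diffs da).
rewrite -subr_le0; apply: (@le0_of_geometric _ (8 * `|C1| + 8 * `|C2| + 4 * sqn h * `|C3|)) => N.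
set D := psumC a (l + h) - _ - _.
pose e1 := psumC a (l + h) - psum a N.+1 (l + h).
pose e2 := psumC a l - psum a N.+1 l.
pose e3 := psumC (pseries_diffs a) l - psum (pseries_diffs a) N l.
have := H N; set P := psum a N.+1 (l + h) - _ - _ => HN.
have -> : D = P + ((e1 + - e2) + - (h * e3)).
  have alg (A B C' A1 B1 C4 : R[i]) : A - B - h * C' =
      (A1 - B1 - h * C4) + (((A - A1) + - (B - B1)) + - (h * (C' - C4))) by ring.
  exact: alg.
have le4 (c : R) n : c / 4 ^+ n <= `|c| / 4 ^+ n.
  by rewrite ler_wpM2r ?invr_ge0 ?exprn_ge0 // ler_norm.
have b1 : sqn e1 <= `|C1| / 4 ^+ N.
  exact: le_trans (le_trans (H1 _) (le4 _ _)) (tail4 _ (normr_ge0 _)).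
have b2 : sqn e2 <= `|C2| / 4 ^+ N.
  exact: le_trans (le_trans (H2 _) (le4 _ _)) (tail4 _ (normr_ge0 _)).
have b3 : sqn h * sqn e3 <= sqn h * (`|C3| / 4 ^+ N).
  by rewrite ler_wpM2l ?sqn_ge0 //; exact: le_trans (H3 _) (le4 _ _).
have := sqnD_le P ((e1 + - e2) + - (h * e3)).
have := sqnD_le (e1 + - e2) (- (h * e3)); have := sqnD_le e1 (- e2).
rewrite !sqnN sqnM; clearbody P e1 e2 e3.
move: (sqn (P + _)) (sqn (_ + - (h * e3))) (sqn (e1 + - e2)) HN b1 b2 b3.
move: (sqn P) (sqn e1) (sqn e2) (sqn e3) (sqn h) `|C1| `|C2| `|C3|.
move: (4 ^+ N)^-1 => q {D e1 e2 e3 P H H1 H2 H3 HC lK lhK le4 h1}.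
by move=> *; lra.
Qed.

Lemma derive1_psumC a : decay a ->
  derive1 (psumC a : R[i] -> R[i]^o) = psumC (pseries_diffs a).
Proof.
move=> da; apply/funext => l; have [C HC] := psumC_remainder l da.
rewrite /derive1; apply: cvg_lim => //.
apply/cvgrPdist_lt => e e0.
have [er eE] : exists er : R, e = er%:C.
  by exists (complex.Re e); apply: complex_ext => //=; rewrite ger0_Im // ltW.
have er0 : 0 < er by move: e0; rewrite eE ltcR.
pose d := Num.min 1 (er / (`|C| + 1)).
have C1 : 0 < `|C| + 1 by rewrite ltr_wpDl.
have d0 : 0 < d by rewrite lt_min ltr01 divr_gt0.
near=> h.
have hn0 : h != 0 by near: h; exact: nbhs_dnbhs_neq.
have hd : `|h| < d%:C.
  near: h; apply: dnbhs0_lt; by rewrite ltcR.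
have hsq : sqn h < d ^+ 2 by rewrite -normc_sqn_lt.
have sh0 : 0 < sqn h by rewrite lt_neqAle eq_sym sqn_eq0 hn0 sqn_ge0.
rewrite eE normc_sqn_lt //.
have -> : psumC (pseries_diffs a) l - h^-1 *: (psumC a (h + l) - psumC a l) =
  - (h^-1 * (psumC a (l + h) - psumC a l - h * psumC (pseries_diffs a) l)).
  have alg (x y u : R[i]) : x != 0 -> u - x^-1 * y = - (x^-1 * (y - x * u)).
    by move=> x0; field.
  by rewrite [h + l]addrC; exact: alg.
rewrite sqnN sqnM.
have hV : sqn h^-1 = (sqn h)^-1.
  have e1 : sqn h * sqn h^-1 = 1.
    by rewrite -sqnM divff // -[1]/(1%:C) sqnR expr1n.
  by rewrite -[RHS]mulr1 -e1 mulKf // lt0r_neq0.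
have d1 : d <= 1 by rewrite ge_min lexx.
have dC : d * (`|C| + 1) <= er by rewrite -ler_pdivlMr // ge_min lexx orbT.
have := HC h; rewrite hV => /(_ _) Hh.
have {}Hh : sqn (psumC a (l + h) - psumC a l - h * psumC (pseries_diffs a) l)
   <= C * sqn h ^+ 2 by apply: Hh; rewrite (le_trans (ltW hsq)) // exprn_ile1 // ltW.
rewrite -ltr_pdivlMl ?invr_gt0 // invrK (le_lt_trans Hh) //.
rewrite expr2 mulrA mulrC ltr_pM2l //.
have := ler_norm C; have := normr_ge0 C => n0 n1.
have : (d * (`|C| + 1)) ^+ 2 <= er ^+ 2.
  by rewrite lerXn2r // ?qualifE /= ?ltW // ?mulr_gt0.
have : C * sqn h < (d * (`|C| + 1)) ^+ 2.
  rewrite exprMn mulrC (le_lt_trans (y := sqn h * (`|C| + 1) ^+ 2)) //.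
    by rewrite ler_pM2l //; nra.
  by rewrite ltr_pM2r // exprn_gt0.
by lra.
Unshelve. all: by end_near. Qed.

Definition coef_deriv k a := iter k (@pseries_diffs R) a.

Lemma decay_coef_deriv k a : decay a -> decay (coef_deriv k a).
Proof. by move=> da; elim: k => //= k; exact: decay_diffs. Qed.

Lemma derive1n_psumC k a : decay a ->
  derive1n k (psumC a : R[i] -> R[i]^o) = psumC (coef_deriv k a).
Proof.
move=> da; elim: k => [//|k IH].
by rewrite derive1nS IH derive1_psumC //; exact: decay_coef_deriv.
Qed.

Lemma psumC_real a (t : R) : psumC a t%:C = (psumR a t)%:C.
Proof.
rewrite /psumC /psumR /pseries.
have E n : (a n)%:C * t%:C ^+ n = (a n * t ^+ n)%:C by rewrite rmorphM rmorphXn.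
have -> : (fun n => complex.Re ((a n)%:C * t%:C ^+ n)) = fun n => a n * t ^+ n.
  by apply/funext => n; rewrite E.
have -> : (fun n => complex.Im ((a n)%:C * t%:C ^+ n)) = fun=> 0.
  by apply/funext => n; rewrite E.
congr Complex; rewrite (_ : series _ = fun=> 0) ?lim_cst //.
by apply/funext => n; rewrite /series /= big1.
Qed.

Lemma decay_cvg a (t : R) : decay a -> cvgn (pseries a t).
Proof.
move=> da; have [C HC] := term_bound t%:C da.
have [c _] := geometric_tail (fun n => (HC n).1).
rewrite (_ : pseries a t = series (fun n => complex.Re ((a n)%:C * t%:C ^+ n))) //.
by congr series; apply/funext => n; rewrite -rmorphXn -rmorphM.
Qed.

Lemma deriv_psumR a (t : R) : decay a ->
  is_derive t (1 : R) (psumR a) (psumR (pseries_diffs a) t).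
Proof.
move=> da; apply: (@pseries_snd_diffs _ _ (`|t| + 1)).
- exact: decay_cvg.
- by apply: decay_cvg; exact: decay_diffs.
- by apply: decay_cvg; exact/decay_diffs/decay_diffs.
- by rewrite [ltRHS]ger0_norm ?ltrDl // addr_ge0.
Qed.

End EntireSeries.

(** * Zeros of real entire functions *)

Section RealZeros.
Variable R : realType.
Implicit Types (a : nat -> R) (G : nat -> R -> R) (x y z r t : R) (k m n : nat).

Lemma coef_derivE a k n :
  coef_deriv k a n = (k`! * 'C(n + k, k))%:R * a (n + k)%N.
Proof.
elim: k n => [|k IH] n; first by rewrite addn0 bin0 muln1 mul1r.
rewrite /coef_deriv /= -/(coef_deriv k a) /pseries_diffs IH mulrA -natrM addSnnS.
congr (_%:R * _); rewrite factS mulnCA (mulnC k.+1) -!mulnA; congr (_ * _)%N.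
by rewrite mul_bin_left -addSnnS addnK.
Qed.

Lemma bin_le_pow2 n k : ('C(n, k) <= 2 ^ n)%N.
Proof.
elim: n k => [|n IH] [|k] //; first by rewrite bin0 expn_gt0.
by rewrite binS expnS mul2n -addnn leq_add.
Qed.

(** The coefficient of index n of the k-th derivative is k! C(n + k, k) times
    that of index n + k of the function, and C(n + k, k) <= 2^(n + k); decay at
    the rate (4 r)^(-n) therefore leaves a convergent series in n. *)
Lemma psumR_deriv_bound a r : decay a -> 1 <= r -> exists C, forall k t,
  `|t| <= r -> `|psumR (coef_deriv k a) t| <= C * k`!%:R / (2 * r) ^+ k.
Proof.
move=> da r1; have r0 : 0 < r by rewrite (lt_le_trans ltr01).
have [|C HC] := da (4 * r); first by lra.
have C0 : 0 <= C by apply: le_trans (HC 0%N); rewrite mulr1.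
exists (2 * C) => k t tr.
have term n : `|coef_deriv k a n * t ^+ n| <= C * k`!%:R / (2 * r) ^+ k / 2 ^+ n.
  rewrite coef_derivE !normrM normrX normr_nat.
  have tn : `|t| ^+ n <= r ^+ n by rewrite lerXn2r // qualifE /= ?ltW.
  apply: (@le_trans _ _ ((k`! * 2 ^ (n + k))%:R * `|a (n + k)%N| * r ^+ n)).
    rewrite ler_pM ?mulr_ge0 // ler_wpM2r // ler_nat leq_mul2l bin_le_pow2 orbT //.
  have := HC (n + k)%N; rewrite -ler_pdivlMr ?exprn_gt0 ?mulr_gt0 // => aC.
  apply: (@le_trans _ _ ((k`! * 2 ^ (n + k))%:R * (C / (4 * r) ^+ (n + k)) * r ^+ n)).
    by rewrite ler_wpM2r ?exprn_ge0 ?(ltW r0) // ler_wpM2l.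
  rewrite le_eqVlt; apply/orP; left; apply/eqP.
  rewrite natrM natrX !exprD !exprMn (_ : 4 = 2 * 2 :> R); last by ring.
  rewrite !exprMn; field.
  by rewrite !expf_neq0 // ?lt0r_neq0.
have [_ /(_ 0%N)] := geometric_tail term.
by rewrite expr0 divr1 /series /= big_geq // subr0 -!mulrA.
Qed.

(** Integrating a bound on the m-th derivative m times from the flat point
    gains the factor 1 / m!, which compensates the growth of the derivatives of
    an entire series. *)
Lemma taylor_flat m G (B x0 r : R) :
  (forall k z, is_derive z (1 : R) (G k) (G k.+1 z)) ->
  (forall k, (k < m)%N -> G k x0 = 0) ->
  (forall x, r <= x <= x0 -> `|G m x| <= B) ->
  forall x, r <= x <= x0 -> `|G 0%N x| <= B * (x0 - x) ^+ m / m`!%:R.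
Proof.
elim: m G => [|m IH] G GD G0 GB x xr.
  by rewrite expr0 mulr1 divr1; exact: GB.
have {}IH y : r <= y <= x0 -> `|G 1%N y| <= B * (x0 - y) ^+ m / m`!%:R.
  move=> yr; apply: (IH (fun k => G k.+1)) => // k km; exact: G0.
pose h e z := e * G 0%N z - B * (x0 - z) ^+ m.+1 / m.+1`!%:R.
have key (e : R) : `|e| = 1 -> h e x <= 0.
  move=> e1; have [rx xx0] := andP xr.
  have hx0 : h e x0 = 0 by rewrite /h G0 // subrr expr0n /=; ring.
  have := @deriv_ge0_le R (h e)
    (fun z => e * G 1%N z + B * (x0 - z) ^+ m / m`!%:R) x x0 xx0.
  rewrite hx0; apply.
    move=> z _; rewrite /h; eapply deriv_eq; first by der.
    have u0 : m.+1%:R != 0 :> R by rewrite pnatr_eq0.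
    have w0 : m`!%:R != 0 :> R by rewrite pnatr_eq0 -lt0n fact_gt0.
    rewrite /= factS natrM.
    by move: m.+1%:R m`!%:R u0 w0 => u w u0 w0; field; rewrite u0 w0.
  move=> z /andP[xz zx0].
  have := IH z; rewrite zx0 (le_trans rx xz) => /(_ isT).
  have -> : `|G 1%N z| = `|e * G 1%N z| by rewrite normrM e1 mul1r.
  by rewrite ler_norml => /andP[]; lra.
have := key 1 (normr1 _); have := key (- 1) (normrN1 _).
by rewrite /h ler_norml => ? ?; apply/andP; split; lra.
Qed.

Lemma coef_derivD j k a : coef_deriv j (coef_deriv k a) = coef_deriv (j + k) a.
Proof. by rewrite /coef_deriv iterD. Qed.

Lemma deriv_psumR_coef a k z : decay a ->
  is_derive z (1 : R) (psumR (coef_deriv k a)) (psumR (coef_deriv k.+1 a) z).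
Proof. by move=> da; apply: deriv_psumR; exact: decay_coef_deriv. Qed.

(** The identity theorem for entire series.  The Taylor estimate with m
    derivatives bounds the value at x by a multiple of ((x0 - x) / (2 r))^m, and
    r exceeds the distance from x to x0. *)
Lemma flat_eq0 a (x0 x : R) : decay a -> x <= x0 ->
  (forall k, psumR (coef_deriv k a) x0 = 0) -> psumR a x = 0.
Proof.
move=> da xx0 flat; pose r := `|x| + `|x0| + 1.
have r1 : 1 <= r by rewrite /r; have := normr_ge0 x; have := normr_ge0 x0; lra.
have r0 : 0 < r by rewrite (lt_le_trans ltr01).
have [C HC] := psumR_deriv_bound da r1.
have C0 : 0 <= C.
  have := HC 0%N 0; rewrite normr0 ltW // => /(_ isT).
  by rewrite expr0 divr1 mulr1; apply: le_trans.
apply/eqP; rewrite -normr_eq0 eq_le normr_ge0 andbT.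
apply: (@le0_of_geometric _ _ C) => N; pose m := N.*2.
have := @taylor_flat m (fun k => psumR (coef_deriv k a)) (C * m`!%:R / (2 * r) ^+ m) x0 x.
move=> /(_ (fun k z => deriv_psumR_coef k z da)) H.
have {}H : `|psumR a x| <= C * m`!%:R / (2 * r) ^+ m * (x0 - x) ^+ m / m`!%:R.
  apply: H => [k _|y /andP[xy yx0]|]; rewrite ?flat ?lexx ?xx0 //; apply: HC.
  rewrite /r ler_norml; have := ler_norm x0; have := ler_norm (- x).
  rewrite normrN; have := normr_ge0 x; have := normr_ge0 x0.
  by move=> *; apply/andP; split; lra.
apply: (le_trans H).
have -> : C * m`!%:R / (2 * r) ^+ m * (x0 - x) ^+ m / m`!%:R =
   C / 2 ^+ m * ((x0 - x) ^+ m / r ^+ m).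
  have w0 : m`!%:R != 0 :> R by rewrite pnatr_eq0 -lt0n fact_gt0.
  have p0 : (2 : R) ^+ m != 0 by rewrite expf_neq0.
  have q0 : r ^+ m != 0 by rewrite expf_neq0 // lt0r_neq0.
  rewrite exprMn; move: m`!%:R ((2 : R) ^+ m) (r ^+ m) (_ ^+ m) w0 p0 q0 => w p q t w0 p0 q0.
  by field; rewrite ?w0 ?p0 ?q0.
have -> : 4 ^+ N = 2 ^+ m :> R by rewrite /m -mul2n exprM; congr (_ ^+ _); ring.
rewrite ler_piMr ?divr_ge0 ?exprn_ge0 // -expr_div_n exprn_ile1 //.
  by rewrite divr_ge0 ?subr_ge0 // ltW.
rewrite ler_pdivrMr // mul1r /r.
by have := ler_norm x0; have := ler_norm (- x); rewrite normrN; lra.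
Qed.

(** Flatness at x would force every derivative to vanish at 0, since each
    derivative is itself an entire series flat at x. *)
Lemma finite_order a x : decay a -> 0 <= x ->
  (exists k, psumR (coef_deriv k a) 0 != 0) ->
  exists m, (forall k, (k < m)%N -> psumR (coef_deriv k a) x = 0) /\
    psumR (coef_deriv m a) x != 0.
Proof.
move=> da x0 [k0 k0P].
have ex : exists m, psumR (coef_deriv m a) x != 0.
  apply: contrapT => nex; move/eqP: k0P; apply.
  apply: (flat_eq0 (decay_coef_deriv k0 da) x0) => k.
  rewrite coef_derivD; apply/eqP; apply: contrapT => /negP h.
  by apply: nex; eexists; exact: h.
exists (ex_minn ex); case: ex_minnP => m mP mmin; split=> // k km.
by apply/eqP; apply: contraLR km => /mmin; rewrite -leqNgt.
Qed.

(** By the mean value theorem the sign of a function vanishing at x0 is that of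
    its derivative to the right of x0 and the opposite one to the left, so each
    derivative removed contributes one factor -1 on the left. *)
Lemma sign_near_zero m G (x0 : R) :
  (forall k z, is_derive z (1 : R) (G k) (G k.+1 z)) ->
  (forall k, (k < m)%N -> G k x0 = 0) -> G m x0 != 0 ->
  exists2 e, 0 < e & forall y,
    (x0 < y < x0 + e -> Num.sg (G 0%N y) = Num.sg (G m x0)) /\
    (x0 - e < y < x0 -> Num.sg (G 0%N y) = (-1) ^+ m * Num.sg (G m x0)).
Proof.
elim: m G => [|m IH] G GD G0 Gm.
  have c : {for x0, continuous (G 0%N)} := deriv_continuous (GD 0%N x0).
  have g0 : 0 < `|G 0%N x0| by rewrite normr_gt0.
  have /cvgr_dist_lt/(_ _ g0)/nbhs_ballP[e e0 eP] := c.
  exists e => // y.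
  have sg_eq : `|x0 - y| < e -> Num.sg (G 0%N y) = Num.sg (G 0%N x0).
    move=> /eP /=; case: (ltrgt0P (G 0%N x0)) Gm => // g _ d.
      rewrite !gtr0_sg //; move: d; rewrite ltr_norml => /andP[]; lra.
    rewrite !ltr0_sg //; move: d; rewrite ltr_norml => /andP[]; lra.
  by rewrite expr0 mul1r; split=> /andP[? ?]; apply: sg_eq; rewrite ltr_norml;
    apply/andP; split; lra.
have [e e0 eP] := IH (fun k => G k.+1) (fun k z => GD _ z) (fun k km => G0 k.+1 km) Gm.
exists e => // y; have G00 := G0 0%N isT; split=> /andP[y1 y2].
  have [|c cab] := @MVT R (G 0%N) (G 1%N) x0 y y1.
  - by apply: continuous_subspaceT => z; exact: deriv_continuous (GD 0%N z).
  rewrite G00 subr0 => ->; rewrite sgrM (gtr0_sg (_ : 0 < y - x0)) ?subr_gt0 // mulr1.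
  move: cab; rewrite in_itv /= => /andP[c1 c2].
  by have [-> //] := eP c; rewrite c1 (lt_trans c2).
have [|c cab] := @MVT R (G 0%N) (G 1%N) y x0 y2.
- by apply: continuous_subspaceT => z; exact: deriv_continuous (GD 0%N z).
rewrite G00 sub0r => e1; have -> : G 0%N y = G 1%N c * (y - x0).
  by rewrite -[LHS]opprK e1 -mulrN opprB.
rewrite sgrM (ltr0_sg (_ : y - x0 < 0)) ?subr_lt0 //.
move: cab; rewrite in_itv /= => /andP[c1 c2].
have [_ ->] := eP c; first by rewrite exprS; ring.
by rewrite c2 andbT (lt_trans y1).
Qed.

(** The supremum of the points reached from 0 is itself reached, and nothing
    below L can be that supremum: a substitute for extracting a finite subcover
    that lets the property carry data along. *)
Lemma interval_induction (H : R -> R -> Prop) (L : R) : 0 <= L ->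
  (forall x y z, 0 <= x -> x <= y -> y <= z -> H x y -> H y z -> H x z) ->
  (forall x, 0 <= x <= L -> exists2 e, 0 < e & forall y z,
     0 <= y -> y <= x <= z -> x - e < y -> z < x + e -> H y z) ->
  H 0 L.
Proof.
move=> L0 Htrans Hloc; pose S := [set x | 0 <= x <= L /\ H 0 x].
have S0 : S 0.
  rewrite /S /= lexx L0; split=> //.
  have [|e e0 He] := Hloc 0; first by rewrite lexx.
  by apply: He; rewrite ?lexx //; lra.
have Sub : has_ubound S by exists L => x [/andP[]].
have Ssup : has_sup S by split=> //; exists 0.
pose s := sup S.
have s0 : 0 <= s by apply: ub_le_sup.
have sL : s <= L by apply: ge_sup => [|x [/andP[]]] //; exists 0.
have [|e e0 He] := Hloc s; first by rewrite s0.
have [x [/andP[x0 xL] Hx] xs] := @sup_adherent R S e e0 Ssup.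
have xs' : x <= s by apply: ub_le_sup => //; split=> //; rewrite x0.
pose z := Num.min L (s + e / 2).
have sz : s <= z by rewrite le_min sL; lra.
have ze : z < s + e by rewrite gt_min; apply/orP; right; lra.
have Hz : H 0 z.
  apply: (Htrans 0 x z) => //; first exact: le_trans xs' sz.
  by apply: He; rewrite // xs'.
have zs : z <= s.
  by apply: ub_le_sup => //; split=> //; rewrite (le_trans s0 sz) ge_min lexx.
have zL : z = L.
  apply/eqP; rewrite eq_le ge_min lexx /= le_min lexx /=.
  move: zs; rewrite ge_min => /orP[|]; lra.
by rewrite -zL.
Qed.

(** The sign of the first nonvanishing derivative at x is the sign of the
    function just to the right of x.  With this convention the statement for
    half-open intervals is additive, and local by the behaviour near one zero. *)
Lemma sign_change_count G (ord : R -> nat) (L : R) : 0 <= L ->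
  (forall k z, is_derive z (1 : R) (G k) (G k.+1 z)) ->
  (forall x, 0 <= x -> (forall k, (k < ord x)%N -> G k x = 0) /\ G (ord x) x != 0) ->
  exists s : seq R, [/\ uniq s,
    forall x, x \in s <-> 0 < x <= L /\ G 0%N x = 0 &
    Num.sg (G (ord L) L) =
      (-1) ^+ (\sum_(x <- s) ord x)%N * Num.sg (G (ord 0) 0)].
Proof.
move=> L0 GD ordP; pose sig x := Num.sg (G (ord x) x).
have ord0 x : 0 <= x -> G 0%N x != 0 -> ord x = 0%N.
  move=> x0; case E : (ord x) => [//|n].
  by have [/(_ 0%N)] := ordP x x0; rewrite E => -> //; rewrite eqxx.
pose H (a b : R) := exists s : seq R, [/\ uniq s,
  forall x, x \in s <-> a < x <= b /\ G 0%N x = 0 &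
  sig b = (-1) ^+ (\sum_(x <- s) ord x)%N * sig a].
suff: H 0 L by [].
apply: interval_induction => // [x y z x0 xy yz|x0 x0L].
  move=> [s [us sP ss]] [t [ut tP st]]; exists (s ++ t); split.
  - rewrite cat_uniq us ut andbT /=; apply/hasPn => w /tP[/andP[yw _] _].
    by apply/negP => /sP[/andP[_]]; rewrite leNgt yw.
  - move=> w; rewrite mem_cat; split.
      case/orP=> [/sP|/tP] [/andP[w1 w2] ->]; rewrite ?w1 ?w2 ?andbT //.
        by rewrite (le_trans w2).
      by rewrite (le_lt_trans xy).
    move=> [/andP[w1 w2] w3]; apply/orP; have [wy|yw] := leP w y.
      by left; apply/sP; rewrite w1 wy.
    by right; apply/tP; rewrite yw w2.
  - by rewrite st ss big_cat exprD /= mulrA; congr (_ * _); rewrite mulrC.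
have x00 : 0 <= x0 by case/andP: x0L.
have [flat nz] := ordP x0 x00.
have [e e0 eP] := sign_near_zero GD flat nz.
have sg_nz : Num.sg (G (ord x0) x0) != 0 by rewrite sgr_eq0.
exists e => // a b a0 /andP[ax xb] ea be.
have bE : sig b = sig x0.
  move: xb; rewrite le_eqVlt => /predU1P[<- //|xb].
  have [/(_ _)h _] := eP b; rewrite /sig ord0 ?h ?xb //.
    by rewrite (le_trans x00) // ltW.
  by rewrite -sgr_eq0 h ?xb.
have nzR y : x0 < y <= b -> G 0%N y != 0.
  move=> /andP[y1 y2]; have [h _] := eP y.
  by rewrite -sgr_eq0 h // y1 (le_lt_trans y2).
have nzL y : a <= y < x0 -> G 0%N y != 0.
  move=> /andP[y1 y2]; have [_ h] := eP y.
  rewrite -sgr_eq0 h ?y2 ?andbT ?(lt_le_trans ea) //.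
  by rewrite mulf_neq0 // signr_eq0.
move: ax; rewrite le_eqVlt => /predU1P[->|ax].
  exists [::]; split=> //; last by rewrite big_nil expr0 mul1r.
  by move=> y; split=> // -[/nzR/eqP].
have aE : sig a = (-1) ^+ ord x0 * sig x0.
  have [_ h] := eP a; rewrite /sig ord0 ?h ?ax ?ea //.
  by apply: nzL; rewrite lexx.
have pmE : sig b = (-1) ^+ ord x0 * sig a.
  by rewrite aE mulrA -exprD addnn -mul2n exprM sqrrN !expr1n mul1r.
have loc y : a < y <= b /\ G 0%N y = 0 -> y = x0.
  move=> [/andP[y1 y2] y3]; case: (ltgtP y x0) => // yx.
    by have := nzL y; rewrite (ltW y1) yx y3 eqxx => /(_ isT).
  by have := nzR y; rewrite y2 yx y3 eqxx => /(_ isT).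
have [z0|nz0] := eqVneq (G 0%N x0) 0.
  exists [:: x0]; split=> //; last by rewrite big_seq1.
  move=> y; rewrite inE; split=> [/eqP ->|/loc ->] //.
  by rewrite ax xb.
exists [::]; split=> //; last by rewrite big_nil; move: pmE; rewrite ord0.
by move=> y; split=> // h; move: (h) => [_]; rewrite (loc _ h) => /eqP; rewrite (negbTE nz0).
Qed.

End RealZeros.

(** * The sign of the determinant for large real parameters *)

Section ComparisonInstability.
Variable R : realType.
Implicit Types (y v p h k r : R -> R) (z L : R).

(** Factor D^2 - g^2 as (D - g) (D + g) and compare twice: first k + g h, then
    h, stay nonnegative. *)
Lemma forced_ge0 (g L : R) h k r : 0 <= g ->
  (forall z, is_derive z (1 : R) h (k z)) ->
  (forall z, is_derive z (1 : R) k (g ^+ 2 * h z + r z)) ->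
  (forall z, 0 <= z <= L -> 0 <= r z) -> h 0 = 0 -> k 0 = 0 ->
  forall z, 0 <= z <= L -> 0 <= h z /\ 0 <= k z.
Proof.
move=> g0 hD kD r0 h0 k0.
have s0 z : 0 <= z <= L -> 0 <= k z + g * h z.
  have D x : is_derive x (1 : R) (fun z => k z + g * h z)
      (g ^+ 2 * h x + r x + g * k x) by derive_by ltac:(ring).
  apply: (linear_comparison (K := g) D) => [x xL|].
    by have := r0 x xL; rewrite expr2; lra.
  by rewrite h0 k0 mulr0 addr0.
have hp z : 0 <= z <= L -> 0 <= h z.
  apply: (linear_comparison (K := - g) hD) => [x xL|]; last by rewrite h0.
  by have := s0 x xL; lra.
move=> z zL; split; first exact: hp.
have [z0 zL'] := andP zL; rewrite -k0.
apply: (@deriv_ge0_le _ k (fun z => g ^+ 2 * h z + r z)) => // x /andP[x0 xz].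
have xL : 0 <= x <= L by rewrite x0 (le_trans xz).
by rewrite addr_ge0 ?r0 // mulr_ge0 ?sqr_ge0 // hp.
Qed.

(** A continuous function cannot change sign without its square vanishing. *)
Lemma sqr_ge1_pos (f df : R -> R) (L : R) :
  (forall z, is_derive z (1 : R) f (df z)) -> f 0 = 1 ->
  (forall z, 0 <= z <= L -> 1 <= f z ^+ 2) -> forall z, 0 <= z <= L -> 0 <= f z.
Proof.
move=> fD f0 f1 z /andP[z0 zL]; rewrite leNgt; apply/negP => fz.
have [||x] := @IVT R f 0 z 0 z0.
- by apply: continuous_subspaceT => x; exact: deriv_continuous (fD x).
- by rewrite f0 ge_min le_max ler01 (ltW fz) orbT.
rewrite in_itv /= => /andP[x0 xz] fx.
by have := f1 x; rewrite x0 (le_trans xz zL) fx expr0n /= ler10 => /(_ isT).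
Qed.

Variables (p y1 v1 y2 v2 : R -> R) (L : R).
Hypotheses (p0 : forall z, 0 <= p z)
  (y1D : forall z, is_derive z (1 : R) y1 (v1 z))
  (v1D : forall z, is_derive z (1 : R) v1 (p z * y1 z))
  (y2D : forall z, is_derive z (1 : R) y2 (v2 z))
  (v2D : forall z, is_derive z (1 : R) v2 (p z * y2 z))
  (y10 : y1 0 = 1) (v10 : v1 0 = 0) (y20 : y2 0 = 0) (v20 : v2 0 = 1).

(** The derivative of y y' is y'^2 + p y^2; consequently y^2 and y'^2 are
    nondecreasing to the right of 0. *)
Lemma product_ge0 y v : (forall z, is_derive z (1 : R) y (v z)) ->
  (forall z, is_derive z (1 : R) v (p z * y z)) -> y 0 * v 0 = 0 ->
  forall z, 0 <= z -> 0 <= y z * v z.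
Proof.
move=> yD vD yv0 z z0; rewrite -yv0.
apply: (@deriv_ge0_le _ (fun z => y z * v z)
   (fun z => p z * y z ^+ 2 + v z ^+ 2)) => // x _.
  by derive_by ltac:(ring).
by rewrite addr_ge0 ?sqr_ge0 // mulr_ge0 ?sqr_ge0.
Qed.

Lemma y1_ge0 z : 0 <= z -> 0 <= y1 z.
Proof.
move=> z0; apply: (@sqr_ge1_pos y1 v1 z) => //; last by rewrite z0 lexx.
move=> x /andP[x0 _]; rewrite -[leLHS](expr1n _ 2) -[X in X ^+ 2]y10.
apply: (@deriv_ge0_le _ (fun z => y1 z ^+ 2) (fun z => 2 * (y1 z * v1 z))) => // t.
  by move=> _; derive_by ltac:(ring).
move=> /andP[t0 _]; rewrite mulr_ge0 //.
by apply: product_ge0 => //; rewrite v10 mulr0.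
Qed.

Lemma v2_ge0 z : 0 <= z -> 0 <= v2 z.
Proof.
move=> z0; apply: (@sqr_ge1_pos v2 (fun z => p z * y2 z) z) => //; last by rewrite z0 lexx.
move=> x /andP[x0 _]; rewrite -[leLHS](expr1n _ 2) -[X in X ^+ 2]v20.
apply: (@deriv_ge0_le _ (fun z => v2 z ^+ 2) (fun z => 2 * (p z * (y2 z * v2 z)))) => // t.
  by move=> _; derive_by ltac:(ring).
move=> /andP[t0 _]; rewrite mulr_ge0 // mulr_ge0 //.
by apply: product_ge0 => //; rewrite y20 mul0r.
Qed.

Lemma y2_ge0 z : 0 <= z -> 0 <= y2 z.
Proof.
move=> z0; rewrite -y20; apply: (@deriv_ge0_le _ y2 v2) => // x /andP[x0 _].
exact: v2_ge0.
Qed.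

(** The trace of the monodromy matrix of y'' = p y compared with that of the
    constant-coefficient equation y'' = g^2 y; the factor e = 1 or -1 selects
    the direction of the inequality. *)
Lemma trace_comparison (g e : R) : 0 < g -> 0 <= L ->
  (forall z, 0 <= e * (p z - g ^+ 2)) ->
  e * (expR (g * L) + expR (- g * L)) <= e * (y1 L + v2 L).
Proof.
move=> g0 L0 pe.
pose C z := (expR (g * z) + expR (- g * z)) / 2.
pose S z := (expR (g * z) - expR (- g * z)) / 2.
have CD z : is_derive z (1 : R) C (g * S z).
  by rewrite /C /S; derive_by ltac:(ring).
have SD z : is_derive z (1 : R) S (g * C z).
  by rewrite /C /S; derive_by ltac:(ring).
have C0 : C 0 = 1 by rewrite /C !mulr0 expR0; lra.
have S0 : S 0 = 0 by rewrite /S !mulr0 expR0; lra.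
have L1 : 0 <= L <= L by rewrite L0 lexx.
have [H1 _] : 0 <= e * (y1 L - C L) /\ 0 <= e * (v1 L - g * S L).
  have D1 z : is_derive z (1 : R) (fun z => e * (y1 z - C z))
    (e * (v1 z - g * S z)) by derive_by ltac:(ring).
  have D2 z : is_derive z (1 : R) (fun z => e * (v1 z - g * S z))
    (g ^+ 2 * (e * (y1 z - C z)) + e * (p z - g ^+ 2) * y1 z).
    by derive_by ltac:(ring).
  apply: (forced_ge0 (ltW g0) D1 D2 _ _ _ L1) => [z /andP[z0 _]||].
  - by rewrite mulr_ge0 // y1_ge0.
  - by rewrite y10 C0 subrr mulr0.
  - by rewrite v10 S0; ring.
have [_ H2] : 0 <= e * (y2 L - S L / g) /\ 0 <= e * (v2 L - C L).
  have gn0 : g != 0 by rewrite lt0r_neq0.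
  have D1 z : is_derive z (1 : R) (fun z => e * (y2 z - S z / g))
    (e * (v2 z - C z)) by derive_by ltac:(by field).
  have D2 z : is_derive z (1 : R) (fun z => e * (v2 z - C z))
    (g ^+ 2 * (e * (y2 z - S z / g)) + e * (p z - g ^+ 2) * y2 z).
    by derive_by ltac:(by field).
  apply: (forced_ge0 (ltW g0) D1 D2 _ _ _ L1) => [z /andP[z0 _]||].
  - by rewrite mulr_ge0 // y2_ge0.
  - by rewrite y20 S0; ring.
  - by rewrite v20 C0 subrr mulr0.
have -> : expR (g * L) + expR (- g * L) = C L + C L by rewrite /C; lra.
by lra.
Qed.

End ComparisonInstability.

Section LargeParameter.
Variable R : realType.

Lemma cosh_lt (x y : R) : `|x| < y -> expR x + expR (- x) < expR y + expR (- y).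
Proof.
wlog x0 : x / 0 <= x => [H|].
  have [x0|x0] := leP 0 x; first exact: H.
  by rewrite -normrN => /H; rewrite opprK (addrC (expR (- x))); apply; lra.
rewrite ger0_norm // => xy; rewrite -subr_gt0.
have -> : expR y + expR (- y) - (expR x + expR (- x)) =
    (expR y - expR x) * (1 - expR (- (x + y))).
  rewrite mulrBl mulrBr mulr1 mulrBr mulr1 -!expRD.
  have -> : y + - (x + y) = - x by ring.
  have -> : x + - (x + y) = - y by ring.
  by ring.
rewrite mulr_gt0 // subr_gt0 ?ltr_expR //.
by rewrite -expR0 ltr_expR; lra.
Qed.

Variables (q : R -> R) (Q a b L l : R).
Hypotheses (q_bound : forall z, `|q z| <= Q) (L0 : 0 < L).
Variables (w11 w21 w12 w22 : R -> R).
Hypotheses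
  (w11D : forall z, is_derive z (1 : R) w11 (w21 z))
  (w21D : forall z, is_derive z (1 : R) w21 ((q z + a * l ^+ 2) * w11 z + b * l * w21 z))
  (w12D : forall z, is_derive z (1 : R) w12 (w22 z))
  (w22D : forall z, is_derive z (1 : R) w22 ((q z + a * l ^+ 2) * w12 z + b * l * w22 z))
  (w110 : w11 0 = 1) (w210 : w21 0 = 0) (w120 : w12 0 = 0) (w220 : w22 0 = 1).

Lemma liouville z : w11 z * w22 z - w21 z * w12 z = expR (b * l * z).
Proof.
pose f z := (w11 z * w22 z - w21 z * w12 z) * expR (- (b * l) * z).
have fD x : is_derive x (1 : R) f 0 by rewrite /f; derive_by ltac:(ring).
have : f z = f 0 by exact: (@is_derive_0_is_cst _ f).
rewrite /f mulr0 expR0 w110 w210 w120 w220 !mulr1 mulr0 subr0 => e.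
have e2 : expR (- (b * l) * z) * expR (b * l * z) = 1.
  by rewrite -expRD -expR0; congr expR; ring.
by rewrite -[LHS]mulr1 -e2 mulrA e mul1r.
Qed.

Let k := b * l / 2.
Let G := a * l ^+ 2 + k ^+ 2.

(** Removing the first-order term by the factor e^(-k z) turns the determinant
    into e^(k L) (2 cosh (k L) - trace), with the trace of y'' = (q + G) y. *)
Lemma det_sign (g e : R) : 0 < g -> e ^+ 2 = 1 -> Q <= G ->
  (forall z, 0 <= e * (q z + G - g ^+ 2)) -> e * k ^+ 2 < e * g ^+ 2 ->
  e * (1 - (w11 L + w22 L) + (w11 L * w22 L - w21 L * w12 L)) < 0.
Proof.
move=> g0 e1 QG qG kg.
have p0 z : 0 <= q z + G.
  by have := q_bound z; rewrite ler_norml => /andP[? _]; lra.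
have H := @trace_comparison R (fun z => q z + G)
  (fun z => expR (- k * z) * (w11 z + k * w12 z))
  (fun z => expR (- k * z) * (w21 z + k * w22 z - k * (w11 z + k * w12 z)))
  (fun z => expR (- k * z) * w12 z)
  (fun z => expR (- k * z) * (w22 z - k * w12 z)) L p0.
have {}H : e * (expR (g * L) + expR (- g * L)) <=
    e * (expR (- k * L) * (w11 L + w22 L)).
  have -> : expR (- k * L) * (w11 L + w22 L) = expR (- k * L) * (w11 L + k * w12 L) +
    expR (- k * L) * (w22 L - k * w12 L) by ring.
  apply: H => //.
  - by move=> z; derive_by ltac:(ring).
  - by move=> z; derive_by ltac:(rewrite /G /k; field).
  - by move=> z; derive_by ltac:(ring).
  - by move=> z; derive_by ltac:(rewrite /G /k; field).
  - by rewrite mulr0 expR0 w110 w120; ring.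
  - by rewrite mulr0 expR0 w110 w120 w210 w220; ring.
  - by rewrite mulr0 expR0 w120; ring.
  - by rewrite mulr0 expR0 w120 w220; ring.
  - exact: ltW.
have cosh_cmp : e * (expR (k * L) + expR (- (k * L))) <
    e * (expR (g * L) + expR (- (g * L))).
  have : (e == 1) || (e == -1).
    have : (e - 1) * (e + 1) == 0 by rewrite -subr_sqr e1 expr1n subrr.
    by rewrite mulf_eq0 subr_eq0 addr_eq0.
  move=> /orP[] /eqP ee; move: kg; rewrite ee.
    rewrite !mul1r => kg; apply: cosh_lt.
    rewrite normrM (gtr0_norm L0) ltr_pM2r // -ltr_sqr ?nnegrE ?(ltW g0) //.
    by rewrite real_normK ?num_real.
  rewrite !mulN1r !ltrN2 => kg.
  have -> : expR (k * L) + expR (- (k * L)) = expR (`|k| * L) + expR (- (`|k| * L)).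
    by case: (ger0P k) => // _; rewrite mulNr opprK addrC.
  apply: cosh_lt; rewrite gtr0_norm ?mulr_gt0 // ltr_pM2r //.
  by rewrite -ltr_sqr ?nnegrE ?(ltW g0) // real_normK ?num_real.
rewrite liouville.
have E0 : 0 < expR (k * L) by exact: expR_gt0.
have EE : expR (k * L) * expR (- k * L) = 1.
  by rewrite -expRD -expR0; congr expR; ring.
have -> : expR (b * l * L) = expR (k * L) * expR (k * L).
  by rewrite -expRD; congr expR; rewrite /k; field.
have -> : e * (1 - (w11 L + w22 L) + expR (k * L) * expR (k * L)) = expR (k * L) *
    (e * (expR (k * L) + expR (- (k * L))) - e * (expR (- k * L) * (w11 L + w22 L))).
  move: EE; rewrite mulNr; move: (expR (k * L)) (expR (- (k * L))) => x y xy.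
  have -> : x * (e * (x + y) - e * (y * (w11 L + w22 L))) =
    e * (x * y - (x * y) * (w11 L + w22 L) + x * x) by ring.
  by rewrite xy mul1r.
by rewrite pmulr_rlt0 // subr_lt0 (lt_le_trans cosh_cmp) // -mulNr.
Qed.

End LargeParameter.

(** * Bounded solutions and the spectrum *)

Section Spectrum.
Variable R : realType.
Let mu := @lebesgue_measure R.
Implicit Types (h dh : R -> R) (e B z : R).

Definition cutoff e z : R := (1 + (e * z) ^+ 2)^-1.
Definition dcutoff e z : R := - (2 * e ^+ 2 * z) * cutoff e z ^+ 2.

Lemma cutoff_den e z : 0 < 1 + (e * z) ^+ 2.
Proof. by rewrite ltr_pwDl ?sqr_ge0. Qed.

Lemma cutoff_gt0 e z : 0 < cutoff e z.
Proof. by rewrite invr_gt0 cutoff_den. Qed.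

Lemma cutoff_le1 e z : cutoff e z <= 1.
Proof. by rewrite invf_le1 ?cutoff_den // lerDl sqr_ge0. Qed.

Lemma cutoff_deriv e z : is_derive z (1 : R) (cutoff e) (dcutoff e z).
Proof.
have D : is_derive z (1 : R) (fun z => 1 + (e * z) ^+ 2) (2 * e ^+ 2 * z).
  by derive_by ltac:(ring).
have := @is_deriveV _ _ z _ _ (lt0r_neq0 (cutoff_den e z)) D.
rewrite (_ : (fun y => _) = cutoff e) // => H; apply: deriv_eq H _.
by rewrite /dcutoff /cutoff exprVn /GRing.scale /=; ring.
Qed.

(** This is 2 e |z| <= 1 + (e z)^2. *)
Lemma dcutoff_le e z : 0 <= e -> `|dcutoff e z| <= e * cutoff e z.
Proof.
move=> e0; rewrite /dcutoff normrM normrN (ger0_norm (sqr_ge0 (cutoff e z))).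
rewrite (expr2 (cutoff e z)) mulrA ler_wpM2r ?(ltW (cutoff_gt0 _ _)) //.
rewrite ler_pdivrMr ?cutoff_den // normrM ger0_norm ?mulr_ge0 ?sqr_ge0 //.
have -> : (e * z) ^+ 2 = (e * `|z|) ^+ 2 by rewrite !exprMn real_normK ?num_real.
have := sqr_ge0 (e * `|z| - 1); have := normr_ge0 z.
move: `|z| => t t0 h; rewrite -subr_ge0.
have -> : e * (1 + (e * t) ^+ 2) - 2 * e ^+ 2 * t = e * (e * t - 1) ^+ 2 by ring.
exact: mulr_ge0.
Qed.

Lemma cutoff_continuous e : continuous (cutoff e).
Proof. by move=> z; exact: deriv_continuous (cutoff_deriv e z). Qed.

Lemma dcutoff_continuous e : continuous (dcutoff e).
Proof.
move=> z; have D := cutoff_deriv e; rewrite /dcutoff.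
suff : is_derive z (1 : R) (fun z => - (2 * e ^+ 2 * z) * cutoff e z ^+ 2)
  (- (2 * e ^+ 2) * cutoff e z ^+ 2 +
   - (2 * e ^+ 2 * z) * (2 * cutoff e z * dcutoff e z)).
  exact: deriv_continuous.
by derive_by ltac:(ring).
Qed.

Lemma integrable_oneDsqrV : mu.-integrable setT (fun x : R => (oneDsqr x)^-1%:E).
Proof.
have pos (x : R) : 0 <= (oneDsqr x)^-1 by rewrite invr_ge0.
apply/integrableP; split.
  by apply/measurable_EFinP; apply: continuous_measurable_fun; exact: continuous_oneDsqrV.
under eq_integral => x _ do rewrite gee0_abs ?lee_fin //.
rewrite ge0_symfun_integralT //; last 2 first.
- exact: continuous_oneDsqrV.
- by move=> x; rewrite /= /oneDsqr sqrrN.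
by rewrite -set_itvcy integral0y_oneDsqr -EFinM ltry.
Qed.

(** For e <= 1 the square of the cutoff is at most a multiple of
    1 / (1 + z^2), which is integrable. *)
Lemma cutoff_L2 e B h : 0 < e <= 1 -> continuous h ->
  (forall z, `|h z| <= B * cutoff e z) -> h \in Lfun mu 2%:E.
Proof.
move=> /andP[e0 e1] hc hB.
have mh : measurable_fun setT h by exact: continuous_measurable_fun.
rewrite inE; apply/andP; split; first by rewrite inE /=.
rewrite inE /= /finite_norm unlock poweR_lty //.
have le z : h z ^+ 2 <= B ^+ 2 / e ^+ 2 * (oneDsqr z)^-1.
  have B0 : 0 <= B.
    by have := le_trans (normr_ge0 _) (hB 0); rewrite pmulr_lge0 // cutoff_gt0.
  rewrite -(real_normK (num_real (h z))).
  apply: (@le_trans _ _ (B ^+ 2 * cutoff e z)).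
    apply: (@le_trans _ _ ((B * cutoff e z) ^+ 2)).
      by rewrite lerXn2r // qualifE /= ?mulr_ge0 // ltW // cutoff_gt0.
    rewrite exprMn ler_wpM2l ?sqr_ge0 // expr2 ler_piMr ?cutoff_le1 //.
    by rewrite ltW // cutoff_gt0.
  rewrite -mulrA ler_wpM2l ?sqr_ge0 // -invfM lef_pV2 ?posrE ?cutoff_den //; last first.
    by rewrite mulr_gt0 ?exprn_gt0 // /oneDsqr ltr_pwDl ?sqr_ge0.
  rewrite /oneDsqr mulrDr mulr1 exprMn lerD2r.
  by rewrite exprn_ile1 // ltW.
have mE : measurable_fun setT (fun z => (h z ^+ 2)%:E).
  by apply/measurable_EFinP; exact: measurable_funX.
have /integrableP[_] : mu.-integrable setT (fun z => (h z ^+ 2)%:E).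
  have H := integrableZl measurableT (B ^+ 2 / e ^+ 2) integrable_oneDsqrV.
  apply: le_integrable H => // z _; rewrite -EFinM !abse_EFin lee_fin ger0_norm ?sqr_ge0 //.
  by rewrite (le_trans (le z)) // ler_norm.
apply: le_lt_trans; rewrite le_eqVlt; apply/orP; left; apply/eqP.
apply: eq_integral => z _.
by rewrite /= powR_mulrn // normrX.
Qed.

Lemma integral_away (k : R -> R) (M N : R) : M < N ->
  (forall z, M < `|z| -> k z = 0) ->
  \int[mu]_z k z = \int[mu]_(z in `[- N, N]) k z.
Proof.
move=> MN k0; rewrite [RHS]Rintegral_mkcond; apply: eq_Rintegral => z _.
rewrite patchE; case: ifPn => // zN; apply: k0.
rewrite (lt_le_trans MN) //; apply: contraNT zN; rewrite -ltNge => zN.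
by rewrite inE /= in_itv /= -ler_norml ltW.
Qed.

(** Integration by parts on a bounded interval outside of which the test
    function and its derivative vanish. *)
Lemma weak_derivative_C1 h dh : (forall z, is_derive z (1 : R) h (dh z)) ->
  continuous dh -> weak_derivative h dh.
Proof.
move=> hD dhc phi [phiD [M phi0]].
have pD z : is_derive z (1 : R) phi (derive1 phi z) by exact/derivable_deriv/(phiD 0%N).
have pc : continuous (derive1 phi).
  move=> z; apply: differentiable_continuous; apply/derivable1_diffP.
  exact: (phiD 1%N).
pose N := `|M| + 1.
have MN : M < N by rewrite (le_lt_trans (ler_norm _)) // ltrDl.
have dphi0 z : M < `|z| -> derive1 phi z = 0.
  move=> Mz; apply: derivE; apply: near_eq_is_derive (deriv_cst 0 z).
  have : \forall y \near z, M < `|y|.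
    have cn : `|y| @[y --> z] --> `|z| by apply: cvg_norm.
    exact: (cvgr_gt _ cn _ Mz).
  by apply: filterS => y /phi0.
have NN : - N < N by rewrite /N; have := normr_ge0 M; lra.
rewrite (integral_away MN) => [|z /dphi0 ->]; last by rewrite mulr0.
rewrite (integral_away MN) => [|z /phi0 ->]; last by rewrite mulr0.
have LR (k dk : R -> R) : (forall z, is_derive z (1 : R) k (dk z)) ->
    derivable_oo_LRcontinuous k (- N) N.
  move=> kD; split=> [z _||]; first by case: (kD z).
    by apply: cvg_at_right_filter; exact: deriv_continuous (kD _).
  by apply: cvg_at_left_filter; exact: deriv_continuous (kD _).
rewrite (@Rintegration_by_parts R h phi dh (derive1 phi)) //.
- rewrite (phi0 N) ?(phi0 (- N)) ?mulr0 ?subrr ?sub0r //.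
    by rewrite normrN (lt_le_trans MN) // ler_norm.
  by rewrite (lt_le_trans MN) // ler_norm.
- exact: continuous_subspaceT.
- exact: LR.
- by move=> z _; exact: derivE.
- exact: continuous_subspaceT.
- exact: LR.
Qed.

Lemma integral_pos (k : R -> R) : continuous k -> (forall z, 0 <= k z) ->
  mu.-integrable setT (EFin \o k) -> 0 < k 0 -> 0 < \int[mu]_z k z.
Proof.
move=> kc k0 ki kp.
have /cvgr_gt : k z @[z --> 0] --> k 0 by exact: kc.
move=> /(_ (k 0 / 2)); rewrite ltr_pdivrMr // ltr_pMr // ltr1n => /(_ isT).
move=> /nbhs_ballP[d d0 dP]; pose r := d / 2.
have r0 : 0 < r by rewrite divr_gt0.
have mk : measurable_fun setT (EFin \o k) by case/integrableP: ki.
have H : ((k 0 / 2 * r)%:E <= \int[mu]_z (k z)%:E)%E.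
  apply: (@le_trans _ _ (\int[mu]_(z in `[0%R, r]) (k z)%:E)%E); last first.
    by apply: ge0_subset_integral => // z _; rewrite lee_fin.
  apply: (@le_trans _ _ (\int[mu]_(z in `[0%R, r]) (k 0 / 2)%:E)%E).
    rewrite integral_cst //= lebesgue_measure_itv /= lte_fin r0 -EFinB subr0.
    by rewrite -EFinM.
  apply: ge0_le_integral => //.
  - by move=> z _; rewrite lee_fin divr_ge0 // ltW.
  - exact: measurable_funTS.
  move=> z /=; rewrite in_itv /= => /andP[z0 zr]; rewrite lee_fin ltW //.
  apply: dP; rewrite /ball /= sub0r normrN ger0_norm // (le_lt_trans zr) //.
  by rewrite /r ltr_pdivrMr // ltr_pMr // ltr1n.
rewrite /Rintegral -lte_fin fineK; last exact: integrable_fin_num.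
by apply: lt_le_trans H; rewrite lte_fin mulr_gt0 // divr_gt0.
Qed.

Variables (V f : R -> R) (c : R) (l : R[i]) (w : R -> 'cV[R[i]]_2) (B : R).
Let Aw z i : R[i] := (coefA V c f z l *m w z) i 0.
Hypotheses (wD : forall z i, is_deriveC (fun x => w x i 0) z (Aw z i))
  (Re_cont : forall i, continuous (fun z => complex.Re (Aw z i)))
  (Im_cont : forall i, continuous (fun z => complex.Im (Aw z i)))
  (w_bound : forall z i, sqn (w z i 0) <= B ^+ 2 /\ sqn (Aw z i) <= B ^+ 2)
  (B_ge0 : 0 <= B) (w_neq0 : exists i, w 0 i 0 != 0).

Definition trial e z : 'cV[R[i]]_2 := \col_i ((cutoff e z)%:C * w z i 0).
Definition dtrial e z : 'cV[R[i]]_2 :=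
  \col_i ((dcutoff e z)%:C * w z i 0 + (cutoff e z)%:C * Aw z i).
Definition residual e z : 'cV[R[i]]_2 := \col_i ((dcutoff e z)%:C * w z i 0).

Lemma ReZ (a : R) (x : R[i]) : complex.Re (a%:C * x) = a * complex.Re x.
Proof. by rewrite ReM /=; ring. Qed.

Lemma ImZ (a : R) (x : R[i]) : complex.Im (a%:C * x) = a * complex.Im x.
Proof. by rewrite ImM /=; ring. Qed.

Lemma norm_le_of_sqn (x : R[i]) : sqn x <= B ^+ 2 ->
  `|complex.Re x| <= B /\ `|complex.Im x| <= B.
Proof.
move=> xB; split; rewrite -ler_sqr ?nnegrE // real_normK ?num_real //;
  by rewrite (le_trans _ xB) // /sqn ?lerDl ?lerDr sqr_ge0.
Qed.

Lemma trial_component e h dh : 0 < e <= 1 ->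
  (forall z, is_derive z (1 : R) h (dh z)) -> continuous dh ->
  (forall z, `|h z| <= B) -> (forall z, `|dh z| <= B) ->
  [/\ (fun z => cutoff e z * h z) \in Lfun mu 2%:E,
      (fun z => dcutoff e z * h z) \in Lfun mu 2%:E,
      (fun z => dcutoff e z * h z + cutoff e z * dh z) \in Lfun mu 2%:E &
      weak_derivative (fun z => cutoff e z * h z)
        (fun z => dcutoff e z * h z + cutoff e z * dh z)].
Proof.
move=> e01 hD dhc hB dhB; have [e0 e1] := andP e01.
have hc : continuous h by move=> z; exact: deriv_continuous (hD z).
have cE := @cutoff_continuous e; have dcE := @dcutoff_continuous e.
have c1 : continuous (fun z => cutoff e z * h z) by move=> z; apply: cvgM; [exact: cE|exact: hc].
have c2 : continuous (fun z => dcutoff e z * h z) by move=> z; apply: cvgM; [exact: dcE|exact: hc].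
have c3 : continuous (fun z => dcutoff e z * h z + cutoff e z * dh z).
  move=> z; apply: cvgD; first exact: c2.
  by apply: cvgM; [exact: cE|exact: dhc].
have b1 (k : R -> R) z : (forall z, `|k z| <= B) -> `|cutoff e z * k z| <= B * cutoff e z.
  move=> kB; have c0 := ltW (cutoff_gt0 e z).
  by rewrite normrM mulrC (ger0_norm c0) ler_wpM2r.
have b2 z : `|dcutoff e z * h z| <= B * cutoff e z.
  rewrite normrM mulrC ler_pM // (le_trans (dcutoff_le _ (ltW e0))) //.
  by rewrite ler_piMl // ltW // cutoff_gt0.
split.
- by apply: (@cutoff_L2 e B) => // z; exact: b1.
- by apply: (@cutoff_L2 e B) => // z; exact: b2.
- apply: (@cutoff_L2 e (2 * B)) => // z.
  rewrite (le_trans (ler_normD _ _)) //.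
  by have := b2 z; have := b1 dh z dhB; lra.
- apply: weak_derivative_C1 => // z; have cD := cutoff_deriv e.
  by derive_by ltac:(ring).
Qed.

Lemma component_facts e i : 0 < e <= 1 ->
  [/\ (fun z => complex.Re (trial e z i 0)) \in Lfun mu 2%:E,
      (fun z => complex.Re (residual e z i 0)) \in Lfun mu 2%:E,
      (fun z => complex.Re (dtrial e z i 0)) \in Lfun mu 2%:E &
      weak_derivative (fun z => complex.Re (trial e z i 0))
        (fun z => complex.Re (dtrial e z i 0))] /\
  [/\ (fun z => complex.Im (trial e z i 0)) \in Lfun mu 2%:E,
      (fun z => complex.Im (residual e z i 0)) \in Lfun mu 2%:E,
      (fun z => complex.Im (dtrial e z i 0)) \in Lfun mu 2%:E &
      weak_derivative (fun z => complex.Im (trial e z i 0))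
        (fun z => complex.Im (dtrial e z i 0))].
Proof.
move=> e01.
have E1 : (fun z => complex.Re (trial e z i 0)) = fun z => cutoff e z * complex.Re (w z i 0).
  by apply/funext => z; rewrite mxE ReZ.
have E2 : (fun z => complex.Re (residual e z i 0)) = fun z => dcutoff e z * complex.Re (w z i 0).
  by apply/funext => z; rewrite mxE ReZ.
have E3 : (fun z => complex.Re (dtrial e z i 0)) = fun z =>
    dcutoff e z * complex.Re (w z i 0) + cutoff e z * complex.Re (Aw z i).
  by apply/funext => z; rewrite mxE ReD !ReZ.
have F1 : (fun z => complex.Im (trial e z i 0)) = fun z => cutoff e z * complex.Im (w z i 0).
  by apply/funext => z; rewrite mxE ImZ.
have F2 : (fun z => complex.Im (residual e z i 0)) = fun z => dcutoff e z * complex.Im (w z i 0).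
  by apply/funext => z; rewrite mxE ImZ.
have F3 : (fun z => complex.Im (dtrial e z i 0)) = fun z =>
    dcutoff e z * complex.Im (w z i 0) + cutoff e z * complex.Im (Aw z i).
  by apply/funext => z; rewrite mxE ImD !ImZ.
rewrite E1 E2 E3 F1 F2 F3; split; apply: trial_component => //.
- by move=> z; have [] := wD z i.
- by move=> z; have [/norm_le_of_sqn[]] := w_bound z i.
- by move=> z; have [_ /norm_le_of_sqn[]] := w_bound z i.
- by move=> z; have [] := wD z i.
- by move=> z; have [/norm_le_of_sqn[]] := w_bound z i.
- by move=> z; have [_ /norm_le_of_sqn[]] := w_bound z i.
Qed.

Lemma trial_opT e : 0 < e <= 1 -> opT V c f l (trial e) (residual e).
Proof.
move=> e01; have F i := component_facts i e01; split.
- by move=> i; have [[? _ _ _] [? _ _ _]] := F i.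
- by move=> i; have [[_ ? _ _] [_ ? _ _]] := F i.
exists (dtrial e); split.
- by move=> i; have [[_ _ ? _] [_ _ ? _]] := F i.
- by move=> i; have [[_ _ _ ?] [_ _ _ ?]] := F i.
apply: aeW => z; apply/matrixP => i j; rewrite (ord1 j) !mxE.
rewrite -[X in _ - X](_ : (cutoff e z)%:C * Aw z i = _); first by ring.
rewrite /Aw mxE mulr_sumr; apply: eq_bigr => k _.
by rewrite !mxE; ring.
Qed.

Lemma sqn_integrable (u : R -> 'cV[R[i]]_2) i : inL2 u ->
  mu.-integrable setT (EFin \o (fun z => sqn (u z i 0))).
Proof.
move=> /(_ i)[/Lfun2_integrable_sqr h1 /Lfun2_integrable_sqr h2].
by have := integrableD _ h1 h2; apply.
Qed.

(** The weighted solution is an approximate kernel element: the residual is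
    pointwise at most e times the solution itself. *)
Lemma bounded_solution_in_spectrum : spectrum V c f l.
Proof.
move=> [_ _ [K HK]]; pose e := (`|K| + 1)^-1.
have K1 : 1 <= `|K| + 1 by rewrite lerDr.
have e0 : 0 < e by rewrite invr_gt0 (lt_le_trans ltr01).
have e1 : e <= 1 by rewrite invf_le1 // (lt_le_trans ltr01).
have e01 : 0 < e <= 1 by rewrite e0 e1.
have T := trial_opT e01; have := HK _ _ T.
have [tL2 rL2 _] := T.
pose I (u : R -> 'cV[R[i]]_2) := \sum_(i < 2) \int[mu]_z sqn (u z i 0).
have I0 u : 0 <= I u.
  by apply: sumr_ge0 => i _; apply: Rintegral_ge0 => z _; exact: sqn_ge0.
have nE u : normL2 u = Num.sqrt (I u) by [].
have Ile : I (residual e) <= e ^+ 2 * I (trial e).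
  rewrite /I mulr_sumr; apply: ler_sum => i _.
  rewrite -RintegralZl //; last exact: sqn_integrable.
  apply: le_Rintegral => //; first exact: sqn_integrable.
    by have := integrableZl _ (e ^+ 2) (sqn_integrable i tL2); apply.
  move=> z _; rewrite !mxE !sqnM !sqnR mulrA ler_wpM2r ?sqn_ge0 // -exprMn.
  rewrite -(real_normK (num_real (dcutoff e z))) lerXn2r ?qualifE //=.
    by rewrite mulr_ge0 // ltW // cutoff_gt0.
  exact: dcutoff_le (ltW e0).
have Ipos : 0 < I (trial e).
  have [i wi] := w_neq0.
  rewrite /I (bigD1 i) //= ltr_pwDl //; last first.
    by apply: sumr_ge0 => j _; apply: Rintegral_ge0 => z _; exact: sqn_ge0.
  apply: integral_pos => [|z||].
  - have E : (fun z => sqn (trial e z i 0)) = fun z => cutoff e z ^+ 2 *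
        (complex.Re (w z i 0) ^+ 2 + complex.Im (w z i 0) ^+ 2).
      by apply/funext => z; rewrite mxE sqnM sqnR.
    rewrite E => z; have [d1 d2] := wD z i; have d3 := cutoff_deriv e z.
    apply: deriv_continuous; der.
  - exact: sqn_ge0.
  - exact: sqn_integrable.
  - rewrite mxE sqnM sqnR mulr_gt0 ?exprn_gt0 ?cutoff_gt0 //.
    by rewrite lt_neqAle eq_sym sqn_eq0 wi sqn_ge0.
have npos : 0 < normL2 (trial e) by rewrite nE sqrtr_gt0.
have nle : normL2 (residual e) <= e * normL2 (trial e).
  rewrite !nE -[X in X * _](gtr0_norm e0) -sqrtr_sqr -sqrtrM ?sqr_ge0 //.
  by rewrite ler_sqrt // mulr_ge0 ?sqr_ge0.
have nr0 : 0 <= normL2 (residual e) by rewrite nE sqrtr_ge0.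
move: (normL2 (trial e)) (normL2 (residual e)) npos nle nr0 => x y x0 yx y0 H.
have : x <= `|K| * (e * x).
  apply: (le_trans H); apply: (le_trans (ler_wpM2r y0 (ler_norm K))).
  by rewrite ler_wpM2l.
rewrite mulrA -[leLHS]mul1r ler_pM2r // leNgt => /negP; apply.
by rewrite ltr_pdivrMr ?mul1r ?ltrDl // (lt_le_trans ltr01).
Qed.

End Spectrum.

(** * Floquet theory of the traveling wave *)

Section Periodic.
Variable R : realType.
Implicit Types (g : R -> R) (t z : R).

Lemma derive1_periodic g t : periodic g t -> periodic (derive1 g) t.
Proof.
move=> gt u; rewrite /derive1.
rewrite (_ : (fun h => _) = fun h => h^-1 *: (g (h + u) - g u)) //.
by apply/funext => h; rewrite addrA !gt.
Qed.

Lemma periodic_bounded g t : 0 < t -> periodic g t -> continuous g ->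
  exists B, forall z, `|g z| <= B.
Proof.
move=> t0 gt gc.
have [|m _ mP] := @EVT_max R (fun z => `|g z|) 0 t (ltW t0).
  by apply: continuous_subspaceT => z; apply: cvg_norm; exact: gc.
have pos z : 0 <= z -> `|g z| <= `|g m|.
  move=> z0; pose n := Num.truncn (z / t).
  have /andP[n1 n2] := Num.Theory.truncn_itv (divr_ge0 z0 (ltW t0)).
  rewrite -/n in n1 n2.
  have -> : g z = g (z - t *+ n) by rewrite -[RHS](periodicn gt n) subrK.
  apply: mP; rewrite in_itv /= -mulr_natr; move: n1 n2.
  rewrite ler_pdivlMr // ltr_pdivrMr // -natr1 => n1 n2.
  by apply/andP; split; lra.
exists `|g m| => z; have [|z0] := leP 0 z; first exact: pos.
pose n := (Num.truncn (- z / t)).+1.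
rewrite -(periodicn gt n); apply: pos.
have nz0 : 0 <= - z / t by rewrite divr_ge0 ?ltW // oppr_gt0.
have /andP[_] := Num.Theory.truncn_itv nz0; rewrite -/n.
by rewrite ltr_pdivrMr // -mulr_natr; lra.
Qed.

End Periodic.

Section TwoByTwo.
Variable R : comNzRingType.

Lemma mul22 (A : 'M[R]_2) n (B : 'M[R]_(2, n)) i j :
  (A *m B) i j = A i 0 * B 0 j + A i 1 * B 1 j.
Proof.
rewrite mxE !big_ord_recl big_ord0 addr0.
by have -> : lift ord0 ord0 = 1 :> 'I_2 by exact/val_inj.
Qed.

Lemma det22 (A : 'M[R]_2) : \det A = A 0 0 * A 1 1 - A 0 1 * A 1 0.
Proof.
rewrite (expand_det_row _ 0) !big_ord_recl big_ord0 addr0 /cofactor !det_mx11 !mxE /=.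
have e : lift ord0 ord0 = 1 :> 'I_2 by exact/val_inj.
have e' : lift (lift ord0 ord0) ord0 = 0 :> 'I_2 by exact/val_inj.
by rewrite e' !e expr0 mul1r expr1 mulN1r mulrN.
Qed.

Lemma ord2P (i : 'I_2) : i = 0 \/ i = 1.
Proof. by case: i => -[|[|]] // p; [left|right]; apply/val_inj. Qed.

End TwoByTwo.

Section WaveCoefficient.
Variables (R : realType) (V : R -> R) (E c T : R) (f : R -> R).
Hypotheses (HV : admissible_potential V) (Hf : periodic_wave V E c f)
  (HT : wave_period f T).

Lemma wave_coef_periodic : periodic (fun z => derive1n 2 V (f z)) T.
Proof.
have p2 : periodic (derive1n 2 V) (2 * pi).
  by apply: derive1_periodic; apply: derive1_periodic; exact: potential_periodic HV.
have [_ tp _] := HT; move=> z; case: tp => ->.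
- by [].
- exact: p2.
- by rewrite -[LHS]p2 subrK.
Qed.

Lemma wave_coef_continuous : continuous (fun z => derive1n 2 V (f z)).
Proof.
move=> z; apply: (@continuous_comp _ _ _ f (derive1n 2 V)); last exact: potential_C2 HV _.
by apply: differentiable_continuous; apply/derivable1_diffP; exact: wave_D1 Hf z.
Qed.

End WaveCoefficient.

Section Floquet.
Variables (R : realType) (V : R -> R) (c T : R) (f : R -> R)
  (F : R -> R[i] -> 'M[R[i]]_2).
Let s := c ^+ 2 - 1.
Let q z := - (derive1n 2 V (f z) / s).
Let a := - s^-1.
Let b := 2 * c / s.
Hypotheses (s_neq0 : s != 0) (T_gt0 : 0 < T)
  (Q_per : periodic (fun z => derive1n 2 V (f z)) T)
  (Q_cont : continuous (fun z => derive1n 2 V (f z)))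
  (HF : fundamental_matrix V c f F).
Implicit Types (l : R[i]) (z : R).

Lemma q_cont : continuous q.
Proof. by move=> z; apply: cvgN; apply: cvgM; [exact: Q_cont|exact: cvg_cst]. Qed.

Lemma q_per : periodic q T.
Proof. by move=> z; have e := Q_per z; rewrite /q [derive1n 2 V (f (z + T))]e. Qed.

Lemma q_bounded : exists2 Q, 0 <= Q & forall z, `|q z| <= Q.
Proof.
have [Q HQ] := periodic_bounded T_gt0 q_per q_cont.
by exists Q => //; exact: le_trans (HQ 0).
Qed.

Definition alpha l z : R[i] := (q z)%:C + a%:C * l ^+ 2.

Lemma coefA_row0 z l n (w : 'M[R[i]]_(2, n)) j : (coefA V c f z l *m w) 0 j = w 1 j.
Proof. by rewrite mul22 /coefA !mxE /= mul0r mul1r add0r. Qed.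

Lemma coefA_row1 z l n (w : 'M[R[i]]_(2, n)) j :
  (coefA V c f z l *m w) 1 j = alpha l z * w 0 j + b%:C * l * w 1 j.
Proof.
have sC : (s%:C : R[i]) != 0 by rewrite fmorph_eq0.
rewrite mul22 /coefA !mxE /= -/s /alpha /q /a /b.
rewrite !rmorphN !rmorphM /= !fmorphV /= (_ : (2 : R)%:C = 2); last by rewrite rmorph_nat.
by field.
Qed.

Lemma coefA_per z l : coefA V c f (z + T) l = coefA V c f z l.
Proof.
have e : derive1n 2 V (f (z + T)) = derive1n 2 V (f z) := Q_per z.
by rewrite /coefA e.
Qed.

Lemma alpha_bounded l : exists A, forall z, sqn (alpha l z) <= A.
Proof.
have [Q Q0 HQ] := q_bounded.
exists (2 * Q ^+ 2 + 2 * sqn (a%:C * l ^+ 2)) => z.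
rewrite (le_trans (sqnD_le _ _)) // lerD2r ler_wpM2l // sqnR.
by rewrite -(real_normK (num_real (q z))) lerXn2r ?qualifE //=.
Qed.

Section Solution.
Variables (l : R[i]) (w : R -> 'cV[R[i]]_2).
Hypothesis wD : forall z i, is_deriveC (fun x => w x i 0) z
  ((coefA V c f z l *m w z) i 0).

Lemma sol_D0 z : is_deriveC (fun x => w x 0 0) z (w z 1 0).
Proof. by have := wD z 0; rewrite coefA_row0. Qed.

Lemma sol_D1 z : is_deriveC (fun x => w x 1 0) z
  (alpha l z * w z 0 0 + b%:C * l * w z 1 0).
Proof. by have := wD z 1; rewrite coefA_row1. Qed.

(** w(z + T) - w(z) solves the same system and vanishes at 0. *)
Lemma sol_periodic : w T = w 0 -> forall z, w (z + T) = w z.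
Proof.
move=> wT z; have [A HA] := alpha_bounded l.
have sh (h : R -> R[i]) x y : is_deriveC h (x + T) y -> is_deriveC (fun x => h (x + T)) x y.
  have D : is_derive x (1 : R) (fun x => x + T) 1 by derive_by ltac:(ring).
  move=> [h1 h2]; split.
    by apply: deriv_eq (@deriv_comp R _ (fun x => x + T) x _ _ h1 D) _; rewrite mulr1.
  by apply: deriv_eq (@deriv_comp R _ (fun x => x + T) x _ _ h2 D) _; rewrite mulr1.
have [||||e0 e1] := @system_uniq R A (alpha l) (b%:C * l)
  (fun z => w (z + T) 0 0 - w z 0 0) (fun z => w (z + T) 1 0 - w z 1 0) _ _ HA _ _ z.
- by move=> x; exact: derivCD (sh _ _ _ (sol_D0 _)) (derivCN (sol_D0 _)).
- move=> x; apply: derivC_eq (derivCD (sh _ _ _ (sol_D1 _)) (derivCN (sol_D1 _))) _.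
  by rewrite /alpha q_per; ring.
- by rewrite add0r wT subrr.
- by rewrite add0r wT subrr.
apply/matrixP => i j; rewrite (ord1 j); apply/eqP; rewrite -subr_eq0; apply/eqP.
by case: (ord2P i) => ->.
Qed.

Lemma periodic_sol_spectrum : w T = w 0 -> w 0 != 0 -> spectrum V c f l.
Proof.
move=> wT w0; have wper := sol_periodic wT.
pose Aw z i := (coefA V c f z l *m w z) i 0.
have cw i : continuous (fun z => complex.Re (w z i 0)) /\
    continuous (fun z => complex.Im (w z i 0)).
  by split=> z; have [h1 h2] := wD z i; [exact: deriv_continuous h1|exact: deriv_continuous h2].
have cC (x : R) : continuous (fun _ : R => x) by move=> z; exact: cvg_cst.
have cD (g h : R -> R) : continuous g -> continuous h ->
  continuous (fun z => g z + h z) by move=> gc hc z; apply: cvgD; [exact: gc|exact: hc].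
have cB (g h : R -> R) : continuous g -> continuous h ->
  continuous (fun z => g z - h z) by move=> gc hc z; apply: cvgB; [exact: gc|exact: hc].
have cM (g h : R -> R) : continuous g -> continuous h ->
  continuous (fun z => g z * h z) by move=> gc hc z; apply: cvgM; [exact: gc|exact: hc].
have cA i : continuous (fun z => complex.Re (Aw z i)) /\
    continuous (fun z => complex.Im (Aw z i)).
  case: (ord2P i) => ->; rewrite /Aw.
    have -> : (fun z => complex.Re ((coefA V c f z l *m w z) 0 0)) =
      fun z => complex.Re (w z 1 0) by apply/funext => z; rewrite coefA_row0.
    have -> : (fun z => complex.Im ((coefA V c f z l *m w z) 0 0)) =
      fun z => complex.Im (w z 1 0) by apply/funext => z; rewrite coefA_row0.
    exact: cw.
  have [r0 i0] := cw 0; have [r1 i1] := cw 1.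
  have ca : continuous (fun z => complex.Re (alpha l z)).
    have -> : (fun z => complex.Re (alpha l z)) = fun z => q z + complex.Re (a%:C * l ^+ 2).
      by apply/funext => z; rewrite /alpha ReD.
    exact: cD _ _ q_cont (cC _).
  have ci : (fun z => complex.Im (alpha l z)) = fun=> complex.Im (a%:C * l ^+ 2).
    by apply/funext => z; rewrite /alpha ImD add0r.
  have cai : continuous (fun z => complex.Im (alpha l z)) by rewrite ci; exact: cC.
  split.
    have -> : (fun z => complex.Re ((coefA V c f z l *m w z) 1 0)) = fun z =>
        complex.Re (alpha l z) * complex.Re (w z 0 0) -
        complex.Im (alpha l z) * complex.Im (w z 0 0) +
        (complex.Re (b%:C * l) * complex.Re (w z 1 0) -
         complex.Im (b%:C * l) * complex.Im (w z 1 0)).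
      by apply/funext => z; rewrite coefA_row1 ReD (ReM (alpha l z)) (ReM (b%:C * l)).
    exact: cD _ _ (cB _ _ (cM _ _ ca r0) (cM _ _ cai i0)) (cB _ _ (cM _ _ (cC _) r1) (cM _ _ (cC _) i1)).
  have -> : (fun z => complex.Im ((coefA V c f z l *m w z) 1 0)) = fun z =>
      complex.Re (alpha l z) * complex.Im (w z 0 0) +
      complex.Im (alpha l z) * complex.Re (w z 0 0) +
      (complex.Re (b%:C * l) * complex.Im (w z 1 0) +
       complex.Im (b%:C * l) * complex.Re (w z 1 0)).
    by apply/funext => z; rewrite coefA_row1 ImD (ImM (alpha l z)) (ImM (b%:C * l)).
  exact: cD _ _ (cD _ _ (cM _ _ ca i0) (cM _ _ cai r0)) (cD _ _ (cM _ _ (cC _) i1) (cM _ _ (cC _) r1)).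
have bnd (g : R -> R[i]) : (forall z, g (z + T) = g z) ->
    continuous (fun z => complex.Re (g z)) -> continuous (fun z => complex.Im (g z)) ->
    exists B, forall z, sqn (g z) <= B.
  move=> gT c1 c2.
  have [||B HB] := @periodic_bounded R (fun z => sqn (g z)) T T_gt0.
    by move=> z; rewrite gT.
    exact: cD _ _ (cM _ _ c1 c1) (cM _ _ c2 c2).
  by exists B => z; exact: le_trans (ler_norm _) (HB z).
have ApT i z : Aw (z + T) i = Aw z i by rewrite /Aw coefA_per wper.
have wpT i z : w (z + T) i 0 = w z i 0 by rewrite wper.
have [B0 H0] := bnd _ (wpT 0) (cw 0).1 (cw 0).2.
have [B1 H1] := bnd _ (wpT 1) (cw 1).1 (cw 1).2.
have [B2 H2] := bnd _ (ApT 0) (cA 0).1 (cA 0).2.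
have [B3 H3] := bnd _ (ApT 1) (cA 1).1 (cA 1).2.
pose B := `|B0| + `|B1| + `|B2| + `|B3| + 1.
have B1' : 1 <= B by rewrite lerDr !addr_ge0.
have le (x : R) : x <= B -> x <= B ^+ 2.
  by move=> /le_trans; apply; rewrite expr2 ler_peMl // (le_trans ler01).
apply: (@bounded_solution_in_spectrum R V f c l w B wD) => [i|i|z i||].
- exact: (cA i).1.
- exact: (cA i).2.
- have := normr_ge0 B0; have := normr_ge0 B1; have := normr_ge0 B2; have := normr_ge0 B3.
  have := ler_norm B0; have := ler_norm B1; have := ler_norm B2; have := ler_norm B3.
  case: (ord2P i) => ->; split; apply: le; rewrite /B.
  + by have := H0 z; lra.
  + by have := H2 z; rewrite /Aw; lra.
  + by have := H1 z; lra.
  + by have := H3 z; rewrite /Aw; lra.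
- exact: le_trans ler01 B1'.
- apply: contrapT => h; move/eqP: w0; apply; apply/matrixP => i j; rewrite (ord1 j) mxE.
  by apply/eqP; apply: contrapT => /negP w0; apply: h; exists i.
Qed.

End Solution.

End Floquet.

Section Discriminant.
Variables (R : realType) (V : R -> R) (c T : R) (f : R -> R)
  (F : R -> R[i] -> 'M[R[i]]_2).
Let s := c ^+ 2 - 1.
Let q z := - (derive1n 2 V (f z) / s).
Let a := - s^-1.
Let b := 2 * c / s.
Hypotheses (s_neq0 : s != 0) (T_gt0 : 0 < T)
  (Q_per : periodic (fun z => derive1n 2 V (f z)) T)
  (Q_cont : continuous (fun z => derive1n 2 V (f z)))
  (HF : fundamental_matrix V c f F).
Implicit Types (l : R[i]) (z : R).

Lemma F_D0 l z j : is_deriveC (fun x => F x l 0 j) z (F z l 1 j).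
Proof. by have [_ /(_ z 0 j)] := HF l; rewrite coefA_row0. Qed.

Lemma F_D1 l z j : is_deriveC (fun x => F x l 1 j) z
  (((q z)%:C + a%:C * l ^+ 2) * F z l 0 j + b%:C * l * F z l 1 j).
Proof. by have [_ /(_ z 1 j)] := HF l; rewrite coefA_row1. Qed.

Lemma F_0 l i j : F 0 l i j = (i == j)%:R.
Proof. by have [-> _] := HF l; rewrite mxE. Qed.

Lemma F_01 l : [/\ F 0 l 0 0 = 1, F 0 l 0 1 = 0, F 0 l 1 0 = 0 & F 0 l 1 1 = 1].
Proof. by split; rewrite F_0. Qed.

Lemma ReF_D0 z j : is_derive z (1 : R) (fun x => complex.Re (F x 0 0 j))
  (complex.Re (F z 0 1 j)).
Proof. exact: (F_D0 0 z j).1. Qed.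

Lemma ReF_D1 z j : is_derive z (1 : R) (fun x => complex.Re (F x 0 1 j))
  (q z * complex.Re (F z 0 0 j)).
Proof.
apply: deriv_eq (F_D1 0 z j).1 _.
by rewrite expr0n /= !mulr0 mul0r !addr0 ReZ.
Qed.

Lemma column_expands j : exists u v : nat -> R, [/\ decay u, decay v &
  forall l, expands u l (F T l 0 j) /\ expands v l (F T l 1 j)].
Proof.
have [Q Q0 HQ] := q_bounded c T_gt0 Q_per Q_cont.
have q2 z : q z ^+ 2 <= Q ^+ 2.
  by rewrite -(real_normK (num_real (q z))) lerXn2r ?qualifE //=; exact: HQ.
have [e00 e01 e10 e11] := F_01 0.
have [|u [v [du dv uv]]] := @entire_dependence R q (Q ^+ 2) a b T _ _ _ _ _ _ q2
  (ReF_D0 ^~ 0) (ReF_D1 ^~ 0) (ReF_D0 ^~ 1) (ReF_D1 ^~ 1) _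
  (ReF_D0 ^~ j) (ReF_D1 ^~ j) (ltW T_gt0).
  by rewrite e00 e11 e10 e01 /=; ring.
exists u, v; split => // l.
apply: (uv l (fun z => F z l 0 j) (fun z => F z l 1 j)) => [z|z||].
- exact: F_D0.
- exact: F_D1.
- by rewrite !F_0; case: (_ == _).
- by rewrite !F_0; case: (_ == _).
Qed.

Lemma det_D l z : is_deriveC (fun x => \det (F x l)) z (b%:C * l * \det (F z l)).
Proof.
have -> : (fun x => \det (F x l)) = fun x => F x l 0 0 * F x l 1 1 + - (F x l 0 1 * F x l 1 0).
  by apply/funext => x; rewrite det22.
apply: derivC_eq (derivCD (derivCM (F_D0 l z 0) (F_D1 l z 1))
  (derivCN (derivCM (F_D0 l z 1) (F_D1 l z 0)))) _.
by rewrite det22; ring.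
Qed.

(** Liouville's formula gives (det F)' = b l (det F).  So det F is the derivative
    of a solution of w'' = b l w', which is the system with q = a = 0; its base
    solutions at l = 0 are 1 and z. *)
Lemma det_expands : exists2 v : nat -> R, decay v & forall l, expands v l (\det (F T l)).
Proof.
have q0 (z : R) : (0 : R) ^+ 2 <= 0 by rewrite expr0n.
have c0 z : is_derive z (1 : R) (fun=> 1 : R) ((fun=> 0) z).
  exact: deriv_cst.
have d0 (k : R -> R) z : is_derive z (1 : R) (fun=> 1 : R) (0 * k z).
  by rewrite mul0r; exact: deriv_cst.
have n0 (k : R -> R) z : is_derive z (1 : R) (fun=> 0 : R) (0 * k z).
  by rewrite mul0r; exact: deriv_cst.
have i0 z : is_derive z (1 : R) (fun z : R => z) ((fun=> 1) z) by exact: deriv_id.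
have W : 1 * 1 - 0 * 0 = 1 :> R by rewrite mul1r mul0r subr0.
have [u [v [du dv uv]]] := @entire_dependence R (fun=> 0) 0 0 b T
  (fun=> 1) (fun=> 0) (fun z => z) (fun=> 1) (fun z => z) (fun=> 1)
  q0 c0 (n0 _) i0 (d0 _) W i0 (d0 _) (ltW T_gt0).
exists v => // l.
have cR : continuous (fun z => complex.Re (\det (F z l))).
  by move=> z; have [h _] := det_D l z; exact: (deriv_continuous h).
have cI : continuous (fun z => complex.Im (\det (F z l))).
  by move=> z; have [_ h] := det_D l z; exact: (deriv_continuous h).
have [I [ID I0]] := primitive cR; have [J [JD J0]] := primitive cI.
apply: (uv l (fun z => I z +i* J z) (fun z => \det (F z l)) _ _ _ _).2 => [z|z||].
- by split; [exact: ID|exact: JD].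
- apply: derivC_eq (det_D l z) _.
  by rewrite (_ : 0%:C + 0%:C * l ^+ 2 = 0) ?mul0r ?add0r //; rewrite mul0r add0r.
- by rewrite I0 J0.
- by have [-> _] := HF l; rewrite det1.
Qed.

Lemma decayD (u v : nat -> R) : decay u -> decay v -> decay (fun n => u n + v n).
Proof.
move=> du dv r r1; have [C HC] := du r r1; have [C' HC'] := dv r r1.
exists (C + C') => n; apply: le_trans (lerD (HC n) (HC' n)).
rewrite -mulrDl ler_wpM2r ?ler_normD // exprn_ge0 // (le_trans ler01) //.
Qed.

Lemma decayN (u : nat -> R) : decay u -> decay (fun n => - u n).
Proof. by move=> du r r1; have [C HC] := du r r1; exists C => n; rewrite normrN. Qed.

Lemma decay_one : decay (fun n => (n == 0%N)%:R : R).
Proof.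
move=> r r1; exists 1 => -[|n] /=; first by rewrite normr1 mul1r expr0.
by rewrite normr0 mul0r.
Qed.

Lemma expandsD (u v : nat -> R) l g h : expands u l g -> expands v l h ->
  expands (fun n => u n + v n) l (g + h).
Proof.
move=> [C HC] [C' HC']; exists (2 * C + 2 * C') => N.
have -> : g + h - psum (fun n => u n + v n) N l = (g - psum u N l) + (h - psum v N l).
  have -> : psum (fun n => u n + v n) N l = psum u N l + psum v N l.
    by rewrite /psum -big_split; apply: eq_bigr => i _; rewrite rmorphD /= mulrDl.
  by ring.
apply: le_trans (sqnD_le _ _) _.
by have := HC N; have := HC' N; lra.
Qed.

Lemma expandsN (u : nat -> R) l g : expands u l g -> expands (fun n => - u n) l (- g).
Proof.
move=> [C HC]; exists C => N; rewrite -sqnN.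
have -> : - (- g - psum (fun n => - u n) N l) = g - psum u N l.
  have -> : psum (fun n => - u n) N l = - psum u N l.
    by rewrite /psum -sumrN; apply: eq_bigr => i _; rewrite rmorphN /= mulNr.
  by ring.
exact: HC.
Qed.

Lemma expands_one l : expands (fun n => (n == 0%N)%:R) l 1.
Proof.
exists 1 => -[|N].
  by rewrite /psum big_ord0 subr0 expr0 divr1 -[1]/(1%:C) sqnR expr1n.
rewrite /psum big_ord_recl /= expr0 mulr1 big1 ?addr0 ?subrr ?sqn0.
  by rewrite divr_ge0 ?exprn_ge0.
by move=> i _; rewrite mul0r.
Qed.

Lemma floquetDE l : floquetD F T 1 l = 1 + - F T l 0 0 + - F T l 1 1 + \det (F T l).
Proof. by rewrite /floquetD !det22 !mxE /=; ring. Qed.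

Lemma floquetD_entire : exists2 d : nat -> R, decay d & floquetD F T 1 = psumC d.
Proof.
have [u0 [v0 [du0 dv0 uv0]]] := column_expands 0.
have [u1 [v1 [du1 dv1 uv1]]] := column_expands 1.
have [v dv hv] := det_expands.
have dd := decayD (decayD (decayD decay_one (decayN du0)) (decayN dv1)) dv.
eexists; first exact: dd.
apply/funext => l; apply: expands_uniq (psumC_expands l dd); rewrite floquetDE.
apply: expandsD (hv l); apply: expandsD; last exact: expandsN (uv1 l).2.
by apply: expandsD; [exact: expands_one|exact: expandsN (uv0 l).1].
Qed.

(** For real parameters the imaginary parts form a solution with zero initial
    values. *)
Lemma F_real (x z : R) i j : complex.Im (F z x%:C i j) = 0.
Proof.
have [A HA] := alpha_bounded c T_gt0 Q_per Q_cont x%:C.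
have aE y : (q y)%:C + a%:C * x%:C ^+ 2 = (q y + a * x ^+ 2)%:C.
  by rewrite rmorphD rmorphM rmorphXn.
have bE : b%:C * x%:C = (b * x)%:C by exact/esym/rmorphM.
have [||||h0 h1] := @system_uniq R A (fun y => (q y)%:C + a%:C * x%:C ^+ 2) (b%:C * x%:C)
  (fun z => (complex.Im (F z x%:C 0 j))%:C) (fun z => (complex.Im (F z x%:C 1 j))%:C)
  _ _ HA _ _ z.
- by move=> y; apply: derivC_real; exact: (F_D0 x%:C y j).2.
- move=> y; apply: derivC_eq (derivC_real (F_D1 x%:C y j).2) _.
  by rewrite aE bE -!rmorphM -rmorphD ImD !ImZ.
- by rewrite F_0; case: (_ == _).
- by rewrite F_0; case: (_ == _).
by case: (ord2P i) => ->; [case: h0|case: h1].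
Qed.

(** In the notation of the reduced equation k^2 - G = x^2 / s, which is
    eventually larger than the bound Q of q in absolute value and has the sign
    of s.  The constants g^2 = G + Q for s > 0 and g^2 = G - Q for s < 0 then lie
    between the coefficient q + G and k^2. *)
Lemma floquetD_large : exists2 L : R, 0 < L & forall x : R, L <= x ->
  0 < s * complex.Re (floquetD F T 1 x%:C).
Proof.
have [Q Q0 HQ] := q_bounded c T_gt0 Q_per Q_cont.
have s2 : 0 < s ^+ 2 by rewrite exprn_even_gt0.
(* The two summands ensure x^2 > Q |s|, i.e. |k^2 - G| > Q, and x^2 > Q s^2,
   i.e. G > Q; the summand 1 gives x <= x^2. *)
exists (Q * (`|s| + s ^+ 2) + 1) => [|x xL].
  by rewrite ltr_wpDl // mulr_ge0 // addr_ge0 // ltW.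
have x1 : 1 <= x by apply: le_trans xL; rewrite lerDr mulr_ge0 // addr_ge0 // ltW.
have xx : Q * (`|s| + s ^+ 2) < x ^+ 2.
  have : x <= x ^+ 2 by rewrite expr2 ler_peMl // (le_trans ler01).
  by lra.
have Qs : 0 <= Q * `|s| by rewrite mulr_ge0.
have Qs2 : 0 <= Q * s ^+ 2 by rewrite mulr_ge0 // ltW.
have aE y : (q y)%:C + a%:C * x%:C ^+ 2 = (q y + a * x ^+ 2)%:C.
  by rewrite rmorphD rmorphM rmorphXn.
have bE : b%:C * x%:C = (b * x)%:C by exact/esym/rmorphM.
have D0 z j : is_derive z (1 : R) (fun z => complex.Re (F z x%:C 0 j))
  (complex.Re (F z x%:C 1 j)) by exact: (F_D0 x%:C z j).1.
have D1 z j : is_derive z (1 : R) (fun z => complex.Re (F z x%:C 1 j))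
    ((q z + a * x ^+ 2) * complex.Re (F z x%:C 0 j) + b * x * complex.Re (F z x%:C 1 j)).
  by apply: deriv_eq (F_D1 x%:C z j).1 _; rewrite aE bE ReD !ReZ.
have [e00 e01 e10 e11] := F_01 x%:C.
have := @det_sign R q Q a b T x HQ T_gt0 _ _ _ _
  (D0 ^~ 0) (D1 ^~ 0) (D0 ^~ 1) (D1 ^~ 1) _ _ _ _.
rewrite e00 e01 e10 e11 => /(_ erefl erefl erefl erefl) H.
have DE : complex.Re (floquetD F T 1 x%:C) =
    1 - (complex.Re (F T x%:C 0 0) + complex.Re (F T x%:C 1 1)) +
    (complex.Re (F T x%:C 0 0) * complex.Re (F T x%:C 1 1) -
     complex.Re (F T x%:C 1 0) * complex.Re (F T x%:C 0 1)).
  by rewrite floquetDE det22 !ReImE !F_real /=; ring.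
have GE : a * x ^+ 2 + (b * x / 2) ^+ 2 = x ^+ 2 / s ^+ 2.
  by rewrite /a /b /s; field; rewrite -/s.
have kE : (b * x / 2) ^+ 2 = c ^+ 2 * (x ^+ 2 / s ^+ 2) by rewrite /b; field.
have QG : Q <= x ^+ 2 / s ^+ 2 by rewrite ler_pdivlMr //; lra.
have cE : c ^+ 2 = 1 + s by rewrite /s; ring.
rewrite GE kE cE in H; rewrite DE; move: H; set D := 1 - _ + _.
have key : s * (x ^+ 2 / s ^+ 2) * s = x ^+ 2 by field.
set G := x ^+ 2 / s ^+ 2 in QG key *.
have qQ z : - Q <= q z <= Q by rewrite -ler_norml; exact: HQ.
move=> H; have [s0|s0|s0] := ltrgt0P s; last by move: s_neq0; rewrite s0 eqxx.
- have lt : Q < s * G.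
    rewrite -(ltr_pM2r s0) key; move: xx; rewrite (gtr0_norm s0); lra.
  have g0 : 0 <= G + Q by lra.
  have := @H (Num.sqrt (G + Q)) (- 1); rewrite sqrtr_gt0 sqr_sqrtr //.
  move=> H'; have : -1 * D < 0.
    apply: H' => //; [|by ring|move=> z|].
    + by have : 0 < s * G by [exact: le_lt_trans Q0 lt]; rewrite pmulr_rgt0 //; lra.
    + by have := qQ z; move: (q z) => y /andP[_]; lra.
    + by lra.
  by move=> ?; rewrite pmulr_rgt0 //; lra.
- have lt : Q < - s * G.
    have s0' : 0 < - s by rewrite oppr_gt0.
    rewrite -(ltr_pM2r s0') (_ : - s * G * - s = s * G * s); last by ring.
    by rewrite key; move: xx; rewrite (ltr0_norm s0); lra.
  have g0 : 0 <= G - Q by lra.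
  have cG : 0 <= (1 + s) * G by rewrite -cE mulr_ge0 ?sqr_ge0 // (le_trans Q0).
  have := @H (Num.sqrt (G - Q)) 1; rewrite sqrtr_gt0 sqr_sqrtr //.
  move=> H'; have : 1 * D < 0.
    apply: H' => //; [|by ring|move=> z|].
    + by lra.
    + by have := qQ z; move: (q z) => y /andP[]; lra.
    + by lra.
  by move=> ?; rewrite nmulr_rgt0 //; lra.
Qed.

(** A fixed vector of the monodromy matrix is the initial value of a periodic
    solution; it is found in the kernel of the transpose. *)
Lemma periodic_solution l : floquetD F T 1 l = 0 -> exists w : R -> 'cV[R[i]]_2,
  [/\ forall z i, is_deriveC (fun x => w x i 0) z ((coefA V c f z l *m w z) i 0),
      w T = w 0 & w 0 != 0].
Proof.
move=> D0.
have /det0P[v v0 vM] : \det ((F T l - 1%:M)^T) == 0 by rewrite det_tr; apply/eqP.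
have FT : F T l *m v^T = v^T.
  apply/eqP; rewrite -subr_eq0 -[X in _ - X]mul1mx -mulmxBl.
  by rewrite -[_ *m _]trmxK trmx_mul trmxK vM trmx0.
exists (fun z => F z l *m v^T); split.
- move=> z i.
  have -> : (fun x => (F x l *m v^T) i 0) =
      fun x => F x l i 0 * v^T 0 0 + F x l i 1 * v^T 1 0.
    by apply/funext => x; rewrite mul22.
  have [_ HFl] := HF l.
  apply: derivC_eq (derivCD (derivCM (HFl z i 0) (derivC_cst _ _))
    (derivCM (HFl z i 1) (derivC_cst _ _))) _.
  by rewrite mulmxA (mul22 (coefA V c f z l *m F z l)); ring.
- by have [-> _] := HF l; rewrite mul1mx.
- by have [-> _] := HF l; rewrite mul1mx trmx_eq0.
Qed.

Lemma periodic_spectrum_sub : periodic_spectrum F T `<=` spectrum V c f.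
Proof.
move=> l /periodic_solution[w [wD wT w0]].
exact: (periodic_sol_spectrum s_neq0 T_gt0 Q_per Q_cont wD wT w0).
Qed.

(** For real x the real and imaginary parts of a complex solution are separately
    solutions.  The first component does not vanish identically, since the
    second one is its derivative. *)
Lemma growing_solution (x : R) : floquetD F T 1 x%:C = 0 ->
  exists w : R -> R, [/\ periodic w T, exists z, w z != 0 &
    solves_linearized V c f (fun z t => expR (x * t) * w z)].
Proof.
move=> /periodic_solution[w [wD wT w0]].
have wper := sol_periodic s_neq0 T_gt0 Q_per Q_cont wD wT.
have D0 z := sol_D0 wD z.
have D1 z := sol_D1 s_neq0 wD z.
have aE y : alpha V c f x%:C y = (q y + a * x ^+ 2)%:C.
  by rewrite /alpha rmorphD rmorphM rmorphXn.
have bE : (2 * c / (c ^+ 2 - 1))%:C * x%:C = (b * x)%:C by exact/esym/rmorphM.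
have growth (h k : R -> R) : (forall z, is_derive z (1 : R) h (k z)) ->
    (forall z, is_derive z (1 : R) k ((q z + a * x ^+ 2) * h z + b * x * k z)) ->
    solves_linearized V c f (fun z t => expR (x * t) * h z).
  move=> hD kD; exists (fun z t => x * (expR (x * t) * h z)),
    (fun z t => expR (x * t) * k z), (fun z t => x * (x * (expR (x * t) * h z))),
    (fun z t => x * (expR (x * t) * k z)),
    (fun z t => expR (x * t) * ((q z + a * x ^+ 2) * h z + b * x * k z)) => z t.
  split; first split; try by derive_by ltac:(ring).
  rewrite /q /a /b.
  have -> : derive1n 2 V (f z) = s * (derive1n 2 V (f z) / s) by field.
  by rewrite /s; field; rewrite -/s.
have nz : exists z, complex.Re (w z 0 0) != 0 \/ complex.Im (w z 0 0) != 0.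
  apply: contrapT => h; move/eqP: w0; apply.
  have w00 z : w z 0 0 = 0.
    apply: complex_ext; apply/eqP; apply: contrapT => /negP e; apply: h; exists z.
      by left.
    by right.
  have E1 : (fun x => complex.Re (w x 0 0)) = fun=> 0 by apply/funext => z; rewrite w00.
  have E2 : (fun x => complex.Im (w x 0 0)) = fun=> 0 by apply/funext => z; rewrite w00.
  have w10 : w 0 1 0 = 0.
    have [d1 d2] := D0 0; move: d1 d2; rewrite E1 E2 => d1 d2.
    apply: complex_ext.
      by rewrite -(derivE d1); exact: derivE (deriv_cst _ _).
    by rewrite -(derivE d2); exact: derivE (deriv_cst _ _).
  apply/matrixP => i j; rewrite (ord1 j) mxE.
  by case: (ord2P i) => ->.
have [z0 [n0|n0]] := nz.
  exists (fun z => complex.Re (w z 0 0)); split.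
  - by move=> z; rewrite wper.
  - by exists z0.
  - apply: (growth _ (fun z => complex.Re (w z 1 0))) => z; first exact: (D0 z).1.
    by apply: deriv_eq (D1 z).1 _; rewrite aE bE ReD !ReZ.
exists (fun z => complex.Im (w z 0 0)); split.
- by move=> z; rewrite wper.
- by exists z0.
- apply: (growth _ (fun z => complex.Im (w z 1 0))) => z; first exact: (D0 z).2.
  by apply: deriv_eq (D1 z).2 _; rewrite aE bE ImD !ImZ.
Qed.

End Discriminant.

(** * The parity of the number of positive zeros *)

Section RealZeroCount.
Variable R : realType.
Implicit Types (d : nat -> R) (x : R).

Lemma vanishing_order_psumC d x m : decay d ->
  vanishing_order (psumC d) x%:C m <->
  (forall k, (k < m)%N -> psumR (coef_deriv k d) x = 0) /\
  psumR (coef_deriv m d) x != 0.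
Proof.
move=> dd; have E k : derive1n k (psumC d : R[i] -> R[i]^o) x%:C =
    (psumR (coef_deriv k d) x)%:C by rewrite derive1n_psumC // psumC_real.
have inj (y : R) : (y%:C == 0 :> R[i]) = (y == 0) by rewrite fmorph_eq0.
split=> -[h1 h2]; split.
- by move=> k /h1; rewrite E => /eqP; rewrite inj => /eqP.
- by move: h2; rewrite E inj.
- by move=> k /h1; rewrite E => ->.
- by rewrite E inj.
Qed.

Lemma order_unique (g : nat -> R) m n :
  (forall k, (k < m)%N -> g k = 0) -> g m != 0 ->
  (forall k, (k < n)%N -> g k = 0) -> g n != 0 -> m = n.
Proof.
move=> m1 m2 n1 n2; case: (ltngtP m n) => // [/n1|/m1] e.
  by rewrite e eqxx in m2.
by rewrite e eqxx in n2.
Qed.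

(** The signs at the two ends of the half-line determine the parity: near 0 the
    sign is that of the first nonzero derivative, beyond L it is that of e. *)
Lemma positive_zero_parity d n L (e : R) : decay d -> 0 < L ->
  vanishing_order (psumC d) 0 n ->
  (forall x, L <= x -> 0 < e * complex.Re (psumC d x%:C)) ->
  exists N, positive_zero_count (psumC d) N /\
    Num.sg e = (-1) ^+ N * Num.sg (complex.Re (derive1n n (psumC d) 0 : R[i])).
Proof.
move=> dd L0; rewrite -[0]/(0%:C) => v0 large.
have [z1 z2] := (vanishing_order_psumC 0 n dd).1 v0.
have /choice[ ord ordP] : forall x, exists m, 0 <= x ->
    (forall k, (k < m)%N -> psumR (coef_deriv k d) x = 0) /\
    psumR (coef_deriv m d) x != 0.
  move=> x; have [x0|x0] := leP 0 x; last by exists 0%N.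
  by have [|m mP] := finite_order dd x0; [exists n|exists m].
have ord_0 : ord 0 = n.
  have [h1 h2] := ordP 0 (lexx 0).
  exact: (@order_unique (fun k => psumR (coef_deriv k d) 0)).
have [s [us sP sgE]] := @sign_change_count R (fun k => psumR (coef_deriv k d)) ord L
  (ltW L0) (fun k z => deriv_psumR_coef k z dd) ordP.
have largeR x : L <= x -> 0 < e * psumR d x.
  by move=> /large; rewrite psumC_real.
have ordL : ord L = 0%N.
  have [h1 h2] := ordP L (ltW L0).
  apply: (@order_unique (fun k => psumR (coef_deriv k d) L)) => //.
  by have := largeR L (lexx L); apply: contraTneq => /= ->; rewrite mulr0 ltxx.
exists (\sum_(x <- s) ord x)%N; split.
  exists s, ord; split=> // x.
    rewrite psumC_real; split=> [/sP[/andP[x0 _] /= ->]//|[x0 /eqP]].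
    rewrite fmorph_eq0 => /eqP px; apply/sP; rewrite x0 /=; split=> //.
    by rewrite leNgt; apply/negP => /ltW/largeR; rewrite px mulr0 ltxx.
  by move=> /sP[/andP[/ltW x0 _] _]; apply/vanishing_order_psumC; last exact: ordP.
have -> : complex.Re (derive1n n (psumC d) 0%:C : R[i]) = psumR (coef_deriv n d) 0.
  by rewrite derive1n_psumC // psumC_real.
move: sgE; rewrite ordL ord_0 => <-.
have := largeR L (lexx L) => /= h.
have [e0|e0] := ltP 0 e.
  by move: h; rewrite pmulr_rgt0 // => h; rewrite !gtr0_sg.
have {}e0 : e < 0.
  by rewrite lt_neqAle e0 andbT; apply: contraTneq h => ->; rewrite mul0r ltxx.
by move: h; rewrite nmulr_rgt0 // => h; rewrite !ltr0_sg.
Qed.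

End RealZeroCount.

Theorem proposition6p4 (R : realType) (V : R -> R) (umax umin E c T : R)
    (f : R -> R) (F : R -> R[i] -> 'M[R[i]]_2) (gamma : R) :
  admissible_potential V ->
  admissible_params E c ->
  periodic_wave V E c f ->
  normalized_wave V c umax umin f ->
  wave_period f T ->
  fundamental_matrix V c f F ->
  parity_index c (floquetD F T 1) gamma ->
  [/\ periodic_spectrum F T `<=` spectrum V c f,
      exists N : nat, [/\ positive_zero_count (floquetD F T 1) N,
        gamma = 1 -> ~~ odd N & gamma = -1 -> odd N] &
      gamma = -1 ->
        spectrally_unstable V c f /\
        exists l : R, [/\ 0 < l, periodic_spectrum F T l%:C &
          exists w : R -> R, [/\ periodic w T, exists z, w z != 0 &
            solves_linearized V c f (fun z t => expR (l * t) * w z)]]].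
Proof.
move=> HV _ Hf _ HT HF [p [p0 vo gE]].
have s0 : c ^+ 2 - 1 != 0 by rewrite subr_eq0 (wave_speed Hf).
have T0 : 0 < T by have [] := HT.
have Qper := wave_coef_periodic HV HT.
have Qcont := wave_coef_continuous HV Hf.
have sub := periodic_spectrum_sub s0 T0 Qper Qcont HF.
have [d dd DE] := floquetD_entire s0 T0 Qper Qcont HF.
have [L L0 large] := floquetD_large s0 T0 Qper Qcont HF.
have [N [cnt sgE]] : exists N, positive_zero_count (floquetD F T 1) N /\
    Num.sg (c ^+ 2 - 1) =
    (-1) ^+ N * Num.sg (complex.Re (derive1n p.*2 (floquetD F T 1) 0 : R[i])).
  move: vo large; rewrite DE => vo large.
  exact: positive_zero_parity dd L0 vo large.
have gN : gamma = (-1) ^+ N.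
  rewrite gE sgrM sgE -mulrA.
  have /eqP : Num.sg (c ^+ 2 - 1) != 0 by rewrite sgr_eq0.
  rewrite sgE; case: sgrP => _; rewrite ?mulr0 // => _; first by rewrite !mulr1.
  by rewrite mulrNN !mulr1.
have nn : (-1 : R) != 1 by rewrite lt_eqF //; lra.
have g1 : gamma = 1 -> ~~ odd N.
  by rewrite gN -signr_odd; case: (odd N) => //; rewrite expr1 => /eqP; rewrite (negbTE nn).
have g2 : gamma = -1 -> odd N.
  rewrite gN -signr_odd; case: (odd N) => //.
  by rewrite expr0 => /eqP; rewrite eq_sym (negbTE nn).
split=> //; first by exists N.
move=> gm1; have oN := g2 gm1.
have [s [m [_ sP _ NE]]] := cnt.
case: s sP NE => [|x s] sP NE; first by rewrite NE big_nil in oN.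
have [|x0 Dx] := (sP x).1; first by rewrite mem_head.
split.
  move=> /(_ x%:C (sub _ Dx)) /= x00.
  by rewrite x00 ltxx in x0.
exists x; split; [exact: x0|exact: Dx|].
exact: (growing_solution s0 T0 Qper Qcont HF Dx).
Qed.
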